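(* Let $r\ge2$, $d\ge2$ and $n\ge\binom{r+d}{d}$ be integers. Let $\mathbf{p}\in X_{r,d,n}$ be a point configuration that lies on a unique hypersurface $S\subseteq\mathbb{P}^r$ of degree $d$, and let $\mathbf{q}:=\mathbf{p}\cap S^{\mathrm{sing}}$. If $\mathbf{q}$ has a $(d+2)$-secant line, then $\mathbf{p}$ is a singular point of $X_{r,d,n}$.
   Context: The base field $\Bbbk$ is arbitrary; a point of a scheme means a $\Bbbk$-rational point. $X_{r,d,n}\subseteq(\mathbb{P}^r)^n$ is the closed subscheme parametrizing $n$-tuples of points lying on a common degree $d$ hypersurface, with the scheme structure defined by the maximal minors (of size $\binom{r+d}{d}$) of the $\binom{r+d}{d}\times n$ matrix whose $i$-th column is the vector of all degree $d$ monomials in the homogeneous coordinates of the $i$-th point. $\mathbf{q}=\mathbf{p}\cap S^{\mathrm{sing}}$ denotes the tuple of those entries $p_i$ of $\mathbf{p}$ that lie in the singular locus of $S$. An $m$-secant line of a finite set (or tuple) of points is a line passing through $m$ of its points. *)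

(* Defs.v *)
From HB Require Import structures.
From mathcomp Require Import all_boot all_order all_algebra ring_quotient.
From mathcomp Require Import mpoly.

Set Implicit Arguments.
Unset Strict Implicit.
Unset Printing Implicit Defensive.

Import GRing.Theory.
Local Open Scope ring_scope.

(* For an ideal I = (G) and a prime ideal m of A containing I, the local ring *)
(* (A/I)_m is described through A: its prime ideals are the prime ideals of A *)
(* lying between I and m, and identities in it are written with denominators  *)
(* (elements outside m) cleared.                                              *)
Section LocalRing.
Variables (A : comNzRingType) (G : A -> Prop) (m : {pred A}).

Definition ideal_gen (f : A) : Prop :=
  exists (l : nat) (c g : 'I_l -> A),
    (forall i, G (g i)) /\ f = \sum_(i < l) c i * g i.

(* [idealr_closed] includes 1 \notin P. *)
Definition prime_ideal (P : {pred A}) : Prop :=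
  idealr_closed P /\ prime_idealr_closed P.

Definition loc_prime_chain (e : nat) : Prop :=
  exists P : 'I_e.+1 -> {pred A},
    [/\ forall i, prime_ideal (P i),
        forall g, G g -> g \in P ord0,
        {subset P ord_max <= m} &
        forall i j : 'I_e.+1, (i < j)%N ->
          {subset P i <= P j} /\ ~ {subset P j <= P i}].

Definition loc_krull_dim (e : nat) : Prop :=
  loc_prime_chain e /\ forall e', loc_prime_chain e' -> (e' <= e)%N.

(* The maximal ideal of (A/I)_m is generated by e elements; up to units of    *)
(* the local ring, generators may be taken to be images of elements of m.     *)
Definition loc_max_ideal_gen (e : nat) : Prop :=
  exists x : 'I_e -> A,
    (forall i, x i \in m) /\
    forall f, f \in m ->
      exists (s : A) (c : 'I_e -> A),
        s \notin m /\ ideal_gen (s * f - \sum_(i < e) c i * x i).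

Definition loc_regular : Prop :=
  exists e, loc_krull_dim e /\ loc_max_ideal_gen e.

End LocalRing.

Section Charts.
Variable r : nat.

(* The standard chart {x_j <> 0} of P^r: affine coordinates y correspond to   *)
(* the point with j-th homogeneous coordinate 1 and the others given by y.    *)
Definition chart_point (R : nzRingType) (j : 'I_r.+1) (y : 'I_r -> R) :
    'rV[R]_r.+1 :=
  \row_c (if unlift j c is Some l then y l else 1).

Definition chart_coord (k : fieldType) (j : 'I_r.+1) (x : 'rV[k]_r.+1)
    (l : 'I_r) : k :=
  x 0 (lift j l) / x 0 j.

End Charts.

Definition point_ideal (k : fieldType) (N : nat) (a : 'I_N -> k) :
    {pred {mpoly k[N]}} :=
  [pred f : {mpoly k[N]} | f.@[a] == 0].

Section Hypersurface.
Variables (k : fieldType) (r : nat).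

Definition on_hypersurface (F : {mpoly k[r.+1]}) (x : 'rV[k]_r.+1) : Prop :=
  F.@[x 0] = 0.

Definition dehomogenize (j : 'I_r.+1) (F : {mpoly k[r.+1]}) : {mpoly k[r]} :=
  F \mPo [tuple chart_point j (fun l : 'I_r => 'X_l : {mpoly k[r]}) 0 c
         | c < r.+1].

(* Points of P^r are given by nonzero vectors of homogeneous coordinates. The *)
(* local ring does not depend on the chart containing the point.              *)
Definition hypersurface_regular (F : {mpoly k[r.+1]}) (x : 'rV[k]_r.+1) :
    Prop :=
  exists j : 'I_r.+1, x 0 j != 0 /\
    loc_regular (fun g => g = dehomogenize j F) (point_ideal (chart_coord j x)).

Definition hypersurface_singular (F : {mpoly k[r.+1]}) (x : 'rV[k]_r.+1) :
    Prop :=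
  on_hypersurface F x /\ ~ hypersurface_regular F x.

End Hypersurface.

Section Veronese.
Variables (r d : nat).

Definition monomials : seq 'X_{1..r.+1} :=
  [seq s2m t | t : d.-tuple 'I_r.+1 <- enum (basis r.+1 d)].

Lemma size_monomials : size monomials = 'C(r + d, d).
Proof. by rewrite size_basis addnC. Qed.

Lemma uniq_monomials : uniq monomials.
Proof. exact: uniq_basis. Qed.

Lemma mem_monomials (u : 'X_{1..r.+1}) : (u \in monomials) = (mdeg u == d).
Proof. by rewrite basis_cover. Qed.

Definition veronese_mx (R : comNzRingType) (n : nat) (P : 'M[R]_(n, r.+1)) :
    'M[R]_('C(r + d, d), n) :=
  \matrix_(a, i) \prod_(c < r.+1) P i c ^+ (nth 0%MM monomials a : 'X_{1..r.+1}) c.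

(* [s] ranges over all choices of columns: repeated columns give 0 and        *)
(* reorderings only change the sign.                                          *)
Definition maximal_minor (R : comNzRingType) (n : nat) (P : 'M[R]_(n, r.+1))
    (s : 'I_('C(r + d, d)) -> 'I_n) : R :=
  \det (colsub s (veronese_mx P)).

End Veronese.

Arguments veronese_mx {r} d {R n} P.
Arguments maximal_minor {r} d {R n} P s.

Section ConfigurationScheme.
Variables (k : fieldType) (r d n : nat).

(* A k-point of (P^r)^n is a matrix with nonzero rows, row i being a vector   *)
(* of homogeneous coordinates of the i-th point.                              *)
Definition configuration (p : 'M[k]_(n, r.+1)) : Prop :=
  forall i, row i p != 0.

Definition in_X (p : 'M[k]_(n, r.+1)) : Prop :=
  forall s, maximal_minor d p s = 0.

(* The universal point of the chart prod_i {x_{i, j i} <> 0} = A^(n * r).     *)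
Definition chart_configuration (j : 'I_n -> 'I_r.+1) :
    'M[{mpoly k[n * r]}]_(n, r.+1) :=
  \matrix_i chart_point (j i)
    (fun l : 'I_r => 'X_(mxvec_index i l) : {mpoly k[n * r]}).

Definition X_equation (j : 'I_n -> 'I_r.+1) (g : {mpoly k[n * r]}) : Prop :=
  exists s, g = maximal_minor d (chart_configuration j) s.

Definition configuration_coord (j : 'I_n -> 'I_r.+1) (p : 'M[k]_(n, r.+1)) :
    'I_(n * r) -> k :=
  mxvec (\matrix_(i, l) chart_coord (j i) (row i p) l) 0.

Definition X_regular (p : 'M[k]_(n, r.+1)) : Prop :=
  exists j : 'I_n -> 'I_r.+1, (forall i, p i (j i) != 0) /\
    loc_regular (X_equation j) (point_ideal (configuration_coord j p)).

Definition X_singular (p : 'M[k]_(n, r.+1)) : Prop :=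
  in_X p /\ ~ X_regular p.

(* Hypersurfaces of degree d are nonzero forms up to scalars.                 *)
Definition unique_hypersurface (p : 'M[k]_(n, r.+1)) (F : {mpoly k[r.+1]}) :
    Prop :=
  [/\ F \is d.-homog, F != 0, (forall i, on_hypersurface F (row i p)) &
      forall F' : {mpoly k[r.+1]}, F' \is d.-homog -> F' != 0 ->
        (forall i, on_hypersurface F' (row i p)) -> exists c : k, F' = c *: F].

(* The subtuple of p with index set q has an m-secant line; a line is the     *)
(* row space of a 2 x (r+1) matrix of rank 2. Points of the tuple are counted *)
(* by index.                                                                  *)
Definition has_secant_line (m : nat) (p : 'M[k]_(n, r.+1)) (q : 'I_n -> Prop) :
    Prop :=
  exists (L : 'M[k]_(2, r.+1)) (J : {set 'I_n}),
    [/\ \rank L = 2%N, #|J| = m, (forall i, i \in J -> q i) &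
        forall i, i \in J -> (row i p <= L)%MS].

End ConfigurationScheme.

(* Main.v *)
Require Import Defs.
From HB Require Import structures.
From mathcomp Require Import all_boot all_order all_algebra.
From mathcomp Require Import mpoly generic_quotient ring_quotient.
From mathcomp Require Import ring zify.
From Stdlib Require Import Classical ClassicalEpsilon.

(** Suppose that the local ring of X at p is regular, say of Krull dimension e
with a maximal ideal generated by e elements, in the chart of (P^r)^n given by
j. Write N for the binomial coefficient C(r + d, d), M for the N x n matrix of
degree d monomials over the chart, M0 for its value at p, and u for the
coefficient vector of F. Uniqueness of the hypersurface says that the left
kernel of M0 is spanned by u, so M0 has rank N - 1. Two estimates on e
contradict each other.

Dimension: e <= (N - 1) + n (r - 1). Near p the corank of M is exactly one, so
a point of X determines a form, up to a scalar, and n points on it, which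
leaves N - 1 + n (r - 1) parameters. This is [X_chain_bound]. To bound chains of
primes P_0 < ... < P_e without transcendence degrees, elements
f_i of P_(i+1) outside P_i are chosen; they are algebraically independent modulo
P_0, so they give T^e independent monomials with exponents below T
([power_product_free]). Modulo P_0, on the other hand, a column of cofactors of M
gives a nonzero form vanishing at all the universal points, and dividing by its
leading term in each block of variables leaves only O(T^(N-1+n(r-1))) monomials
to span everything of degree O(T), after multiplication by one nonzero element
([incidence_growth], [chain_bound]).

Tangent space: n r <= e + (n - N). The differentials at p of the maximal minors
all lie in the image of ker M0, of dimension n - N + 1, under the map sending v
to the sum of the v_i dF(p_i) ([gradient_maximal_minor]). This map has a kernel:
forms of degree d restricted to a line make up a space of dimension d + 1, so the
columns of M0 at the d + 2 points on the line satisfy a linear relation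
([secant_relation]), and dF vanishes at these points because they are singular.
Hence the differentials span at most n - N dimensions, and e generators must
account for the others ([embedding_dim]). Adding the two estimates gives
n r <= n r - 1.

That dF vanishes at a singular point is the Jacobian criterion
[smooth_regular]: at a point of f = 0 where some partial derivative is nonzero,
the local ring is regular. Its maximal ideal is generated by the other
coordinates; chains cannot be longer because the zero ideal can be put in front;
and a chain of full length is read off from the implicit function solving
f = 0, as kernels of morphisms to power series. *)

Set Implicit Arguments.
Unset Strict Implicit.
Unset Printing Implicit Defensive.

Import GRing.Theory.
Local Open Scope ring_scope.

(** * Chains of primes and the growth of the quotient *)

Section PrimeIdeals.
Variables (A : comNzRingType) (P : {pred A}).
Hypothesis primeP : prime_ideal P.

Lemma prime_mem0 : 0 \in P. Proof. by case: primeP => -[]. Qed.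
Lemma prime_mem1 : 1 \notin P. Proof. by case: primeP => -[]. Qed.
Lemma prime_memMl a u : u \in P -> a * u \in P.
Proof.
by case: primeP => -[P0 _ PD] _ uP; rewrite -[a * u]addr0 PD.
Qed.
Lemma prime_memD u v : u \in P -> v \in P -> u + v \in P.
Proof. by case: primeP => -[_ _ PD] _ uP vP; rewrite -[u]mul1r PD. Qed.
Lemma prime_memN u : u \in P -> - u \in P.
Proof. by move=> uP; rewrite -mulN1r prime_memMl. Qed.
Lemma prime_memM u v : u * v \in P -> u \notin P -> v \in P.
Proof. by case: primeP => _ h /h /orP[-> // | ->]. Qed.
Local Open Scope quotient_scope.
(** The quotient of A by P, whose integrality is expressed by an explicit
zero-product rule since B carries no choice of units. *)
Lemma prime_quotient :
  exists (B : comNzRingType) (pi : {rmorphism A -> B}),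
    (forall x y : B, x * y = 0 -> x = 0 \/ y = 0) /\
    (forall x, (x \in P) = (pi x == 0)).
Proof.
case: (primeP) => idP prP.
pose mI := isIdealr.Build A P idP.
pose mP := isPrimeIdealrClosed.Build A P prP.
pose I : prime_idealr A := HB.pack (P : A -> bool) mI mP.
exists {ideal_quot I}, (\pi_{ideal_quot I} : {rmorphism A -> {ideal_quot I}}).
split; last first.
  move=> x; rewrite -(rmorph0 (\pi_{ideal_quot I} : {rmorphism A -> _})).
  by rewrite -Quotient.idealrBE subr0.
by move=> x y /Quotient.rquot_IdomainAxiom /orP[] /eqP; [left|right].
Qed.

End PrimeIdeals.

Section IndependentMonomials.
Variables (k : fieldType) (A : comAlgType k).

(** Exponent vectors with e entries below T, as nested pairs so that induction on
e splits off the first factor of a power product. *)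
Fixpoint exponents (T e : nat) : finType :=
  if e is e'.+1 then ('I_T * exponents T e')%type else unit.

Fixpoint power_product (T e : nat) (f : nat -> A) : exponents T e -> A :=
  match e return exponents T e -> A with
  | 0 => fun _ => 1
  | e'.+1 => fun a => f 0 ^+ a.1 * power_product (fun i => f i.+1) a.2
  end.

Lemma card_exponents T e : #|{: exponents T e}| = (T ^ e)%N.
Proof.
elim: e => [|e IH] /=; first by rewrite card_unit.
by rewrite card_prod card_ord IH expnS.
Qed.

(** Elements picked from the successive steps of a prime chain are algebraically
independent modulo its first member. In a relation, the lowest power of f 0 can be
cancelled because f 0 is not in the prime Q 0; reducing modulo Q 1, which
contains f 0, leaves a relation between f 1, f 2, ... for the shorter chain. *)
Lemma power_product_free T e (Q : nat -> {pred A}) (f : nat -> A) :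
  (forall i, (i <= e)%N -> prime_ideal (Q i)) ->
  (forall i, (i < e)%N -> {subset Q i <= Q i.+1}) ->
  (forall i, (i < e)%N -> f i \in Q i.+1 /\ f i \notin Q i) ->
  forall lam : exponents T e -> k,
    \sum_a lam a *: power_product f a \in Q 0%N -> forall a, lam a = 0.
Proof.
elim: e Q f => [|e IH] Q f prQ subQ fQ lam.
  have pr := prQ 0 isT.
  rewrite (big_pred1 tt) => [|[]//] /= h [].
  apply: contraNeq (prime_mem1 pr) => nz.
  have := prime_memMl pr (lam tt)^-1%:A h.
  by rewrite mulr_algl scalerA mulVf // scale1r.
have pr0 := prQ 0 isT.
set f' := fun i => f i.+1.
pose G (j : 'I_T) := \sum_a lam (j, a) *: power_product f' (a : exponents T e).
move=> sumQ.
have sumE : \sum_a lam a *: power_product f a = \sum_(j < T) f 0%N ^+ j * G j.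
  rewrite /= (eq_bigr (fun a => lam (a.1, a.2) *: (f 0%N ^+ a.1 * power_product f' a.2)));
    last by case.
  rewrite -(pair_bigA _ (fun a b => lam (a, b) *: (f 0%N ^+ a * power_product f' b))) /=.
  apply: eq_bigr => j _; rewrite mulr_sumr; apply: eq_bigr => a _.
  by rewrite scalerAr.
rewrite {}sumE in sumQ.
suff lam0 m : forall j : 'I_T, (j < m)%N -> forall a, lam (j, a) = 0.
  by case=> j a; apply: (lam0 T).
elim: m => [//|m IHm] j; rewrite ltnS leq_eqVlt => /orP[/eqP jm|]; last exact: IHm.
apply: (IH (fun i => Q i.+1) f' (fun i => prQ i.+1) (fun i => subQ i.+1) (fun i => fQ i.+1)).
have [f1 f0] := fQ 0%N isT.
(* All coefficients below j vanish: factor out f 0 ^ j, the rest being R times f 0. *)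
pose R := \sum_(i < T | (j < i)%N) f 0%N ^+ (i - j).-1 * G i.
have fact : \sum_(i < T) f 0%N ^+ i * G i = f 0%N ^+ j * (G j + f 0%N * R).
  rewrite (bigID (fun i : 'I_T => (i < j)%N)) /= big1 => [|i ij]; last first.
    rewrite /G big1 ?mulr0 // => a _.
    by rewrite IHm ?scale0r // -jm.
  rewrite add0r (bigD1 j) /= ?ltnn // mulrDr; congr (_ + _).
  rewrite /R !mulr_sumr; apply: eq_big => [i|i /andP[]].
    by rewrite -leqNgt ltn_neqAle eq_sym andbC.
  rewrite -leqNgt => ji ij; have ltji : (j < i)%N by rewrite ltn_neqAle eq_sym ij.
  rewrite !mulrA -exprSr -exprD; congr (_ ^+ _ * _).
  by rewrite -subnS subnKC.
rewrite fact in sumQ.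
have fj : f 0%N ^+ j \notin Q 0%N.
  elim: (j : nat) => [|i IHi]; first by rewrite expr0 prime_mem1.
  rewrite exprS; apply: contra IHi => h; exact: prime_memM h f0.
have {}sumQ := subQ 0%N isT _ (prime_memM pr0 sumQ fj).
have pr1 := prQ 1%N isT.
rewrite /= -/(G j) -[G j](addrK (f 0%N * R)).
apply: (prime_memD pr1 sumQ); apply: (prime_memN pr1).
by rewrite mulrC; apply: (prime_memMl pr1).
Qed.

End IndependentMonomials.

Lemma dependent_family (k : fieldType) (I J : finType) (c : I -> J -> k) :
  (#|J| < #|I|)%N ->
  exists2 lam : I -> k, (exists i, lam i != 0) & forall j, \sum_i lam i * c i j = 0.
Proof.
move=> ltJI.
pose M := \matrix_(i < #|I|, j < #|J|) c (enum_val i) (enum_val j).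
have : kermx M != 0.
  rewrite -mxrank_eq0 mxrank_ker subn_eq0 -ltnNge.
  exact: leq_ltn_trans (rank_leq_col M) ltJI.
case/rowV0Pn => v /sub_kermxP vM v0.
exists (fun i => v 0 (enum_rank i)).
  have [i vi] : exists i, v 0 i != 0.
    apply/existsP; apply: contraNT v0 => /existsPn h; apply/eqP/rowP => i.
    by rewrite mxE; apply/eqP; rewrite -[_ == _]negbK h.
  by exists (enum_val i); rewrite enum_valK.
move=> j; have /rowP/(_ (enum_rank j)) := vM.
rewrite !mxE => vMj; rewrite -[RHS]vMj.
rewrite (reindex_onto (fun i : 'I_#|{: I}| => enum_val i) enum_rank) /=;
  last by move=> i _; rewrite enum_rankK.
by apply: eq_big => [i|i _]; rewrite ?mxE ?enum_rankK ?enum_valK ?eqxx.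
Qed.
Section ChainBound.
Variables (k : fieldType) (M : nat).
Local Notation A := {mpoly k[M]}.

Definition deg_le (d : nat) (x : A) := {in msupp x, forall m, (mdeg m <= d)%N}.

Lemma deg_leM d1 d2 x y : deg_le d1 x -> deg_le d2 y -> deg_le (d1 + d2) (x * y).
Proof.
move=> hx hy m /msuppM_le /allpairsP[[m1 m2] /= [/hx h1 /hy h2 ->]].
by rewrite mdegD leq_add.
Qed.

Lemma deg_le1 d : deg_le d 1.
Proof. by move=> m; rewrite msupp1 inE => /eqP->; rewrite mdeg0. Qed.

Lemma deg_leX d x i : deg_le d x -> deg_le (i * d) (x ^+ i).
Proof.
move=> hx; elim: i => [|i IH]; first exact: deg_le1.
by rewrite exprS mulSn; apply: deg_leM.
Qed.

Lemma deg_le_power_product T e (f : nat -> A) (a : exponents T e) :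
  deg_le (T * \sum_(i < e) msize (f i)) (power_product f a).
Proof.
elim: e f a => [|e IH] f a; first exact: deg_le1.
rewrite big_ord_recl mulnDr; apply: deg_leM; last exact: IH.
have : deg_le (a.1 * msize (f 0%N)) (f 0%N ^+ a.1).
  by apply: deg_leX => m /msize_mdeg_lt /ltnW.
by move=> h m /h hm; apply: leq_trans hm _; rewrite leq_mul2r ltnW ?orbT.
Qed.

(** At T = C the inequality would contradict D < e. *)
Lemma poly_growth e D C : (forall T, (T.+1 ^ e <= C * T.+1 ^ D)%N) -> (e <= D)%N.
Proof.
move=> h; rewrite leqNgt; apply/negP => ltDe.
have := h C; apply/negP; rewrite -ltnNge.
apply: (@leq_trans (C.+1 ^ D.+1)); last exact: leq_pexp2l.
by rewrite expnS ltn_pmul2r // expn_gt0.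
Qed.

(** If, up to a nonzero factor c, the monomials of degree at most s of the quotient
by Q 0 lie in a space of dimension O(s^D), then D bounds the length of the
chain: the e independent elements of [power_product_free] have bounded degree,
so their T^e power products lie in such a space with s proportional to T. *)
Lemma chain_bound (e D C : nat) (Q : nat -> {pred A})
    (B : comNzRingType) (pi : {rmorphism A -> B}) :
  (forall i, (i <= e)%N -> prime_ideal (Q i)) ->
  (forall i, (i < e)%N -> {subset Q i <= Q i.+1} /\ ~ {subset Q i.+1 <= Q i}) ->
  (forall x y : B, x * y = 0 -> x = 0 \/ y = 0) ->
  (forall x, (x \in Q 0%N) = (pi x == 0)) ->
  (forall s, exists (J : finType) (b : J -> B) (c : B),
     [/\ c <> 0, (#|J| <= C * s.+1 ^ D)%N &
      forall m : 'X_{1..M}, (mdeg m <= s)%N ->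
        exists lam : J -> k, c * pi 'X_[m] = \sum_j pi (lam j)%:MP * b j]) ->
  (e <= D)%N.
Proof.
move=> prQ chQ domB kerQ grow.
have [f fQ] : exists f : nat -> A, forall i, (i < e)%N -> f i \in Q i.+1 /\ f i \notin Q i.
  have ex i : exists x, (i < e)%N -> x \in Q i.+1 /\ x \notin Q i.
    case: (ltnP i e) => [/chQ[_ nsub]|]; last by exists 0.
    apply: NNPP => nex; apply: nsub => x xQ; apply: contraT => nx.
    by case: nex; exists x.
  exists (fun i => proj1_sig (constructive_indefinite_description _ (ex i))).
  by move=> i; apply: proj2_sig (constructive_indefinite_description _ (ex i)).
(* Each factor f i contributes at most T times its degree to a power product. *)
pose E := (\sum_(i < e) msize (f i))%N.
apply: (@poly_growth _ _ (C * E.+1 ^ D)) => T.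
have [J [b [c [c0 cardJ span]]]] := grow (T.+1 * E)%N.
apply: (@leq_trans #|J|); last first.
  apply: leq_trans cardJ _; rewrite -mulnA leq_mul2l -expnMn; apply/orP; right.
  have h : (T.+1 * E < E.+1 * T.+1)%N by rewrite mulnC ltn_mul2r /= ltnS leqnn.
  by elim: (D) => // d IH; rewrite !expnS leq_mul.
have spanE (x : A) : deg_le (T.+1 * E) x ->
    exists lam : J -> k, c * pi x = \sum_j pi (lam j)%:MP * b j.
  rewrite {2}[x]mpolyE /deg_le; elim: (msupp x) => [|m r IH] hr.
    exists (fun _ => 0); rewrite big_nil rmorph0 mulr0 big1 // => j _.
    by rewrite mul0r.
  have [l1 E1] := span m (hr _ (mem_head _ _)).
  have [|l2 E2] := IH; first by move=> m' hm'; apply: hr; rewrite inE hm' orbT.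
  exists (fun j => x@_m * l1 j + l2 j).
  rewrite big_cons rmorphD mulrDr E2 -mul_mpolyC rmorphM mulrCA E1 mulr_sumr.
  rewrite -big_split; apply: eq_bigr => j _ /=.
  by rewrite mpolyCD mpolyCM rmorphD rmorphM mulrDl mulrA.
have [co coE] := fin_all_exists (fun a => spanE _ (@deg_le_power_product T.+1 e f a)).
rewrite -card_exponents leqNgt; apply/negP => /(dependent_family co)[lam [a la] lam0].
have : \sum_a lam a *: power_product f a \in Q 0%N.
  rewrite kerQ; apply/eqP.
  suff : c * pi (\sum_a lam a *: power_product f a) = 0 by case/domB.
  rewrite rmorph_sum mulr_sumr.
  transitivity (\sum_a \sum_j pi (lam a * co a j)%:MP * b j).
    apply: eq_bigr => a' _; rewrite -mul_mpolyC rmorphM mulrCA coE mulr_sumr.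
    by apply: eq_bigr => j _; rewrite mpolyCM rmorphM mulrA.
  rewrite exchange_big big1 // => j _.
  by rewrite -mulr_suml -rmorph_sum -rmorph_sum /= lam0 mpolyC0 rmorph0 mul0r.
have subQ i : (i < e)%N -> {subset Q i <= Q i.+1} by case/chQ.
by move/(power_product_free prQ subQ fQ)/(_ a)/eqP; rewrite (negPf la).
Qed.

End ChainBound.

(** * First-order expansions of polynomials *)

Lemma mpoly_ring_ind (R : comNzRingType) (M : nat) (P : {mpoly R[M]} -> Prop) :
  (forall c, P c%:MP) -> (forall i, P 'X_i) ->
  (forall x y, P x -> P y -> P (x + y)) -> (forall x y, P x -> P y -> P (x * y)) ->
  forall x, P x.
Proof.
move=> PC PX PD PM x; rewrite [x]mpolyE.
elim/big_rec: _ => [|m y _ Py]; first by rewrite -mpolyC0.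
apply: PD => //; rewrite -mul_mpolyC; apply: (PM _ _) => //.
rewrite mpolyXE_id; elim/big_rec: _ => [|i z _ Pz]; first by rewrite -mpolyC1.
apply: (PM _ _) => //; elim: (m i) => [|d IH]; first by rewrite expr0 -mpolyC1.
by rewrite exprS; apply: (PM _ _).
Qed.

Section FirstOrder.
Variables (k : fieldType) (M : nat).
Implicit Types (g : {mpoly k[M]}) (a : 'I_M -> k).

(** The polynomials with such an expansion form a subring containing the constants
and the variables. The values h l at a are the partial derivatives of g
([gradient_hadamard]). *)
Lemma hadamard a g : exists h : 'I_M -> {mpoly k[M]},
  g = (g.@[a])%:MP + \sum_l h l * ('X_l - (a l)%:MP).
Proof.
elim/mpoly_ring_ind: g => [c|i|x y [hx Ex] [hy Ey]|x y [hx Ex] [hy Ey]].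
- exists (fun _ => 0); rewrite mevalC big1 ?addr0 // => l _; exact: mul0r.
- exists (fun l => (l == i)%:R); rewrite (bigD1 i) //= eqxx mul1r big1 => [|l /negPf->].
    by rewrite mevalXU addr0 addrC subrK.
  by rewrite mul0r.
- exists (fun l => hx l + hy l); rewrite {1}Ex {1}Ey rmorphD /= mpolyCD.
  by under [in RHS]eq_bigr do rewrite mulrDl; rewrite big_split /=; ring.
- exists (fun l => hx l * y + (x.@[a])%:MP * hy l).
  rewrite rmorphM /= mpolyCM {1}Ex mulrDl {1}Ey mulrDr -addrA; congr (_ + _).
  under [in RHS]eq_bigr do rewrite mulrDl.
  rewrite big_split /= addrC; congr (_ + _); rewrite ?mulr_sumr ?mulr_suml.
    by apply: eq_bigr => l _; rewrite mulrAC.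
  by apply: eq_bigr => l _; rewrite mulrA.
Qed.

Definition gradient a g : 'rV[k]_M := \row_l (g^`M(l)).@[a].

Lemma gradientD a x y : gradient a (x + y) = gradient a x + gradient a y.
Proof. by apply/rowP => l; rewrite !mxE mderivD mevalD. Qed.

Lemma gradientM a x y :
  gradient a (x * y) = y.@[a] *: gradient a x + x.@[a] *: gradient a y.
Proof.
by apply/rowP => l; rewrite !mxE mderivM mevalD !mevalM mulrC.
Qed.

Lemma gradientC a c : gradient a c%:MP = 0.
Proof. by apply/rowP => l; rewrite !mxE mderivC meval0. Qed.

Lemma gradientX a l : gradient a 'X_l = delta_mx 0 l.
Proof.
apply/rowP => j; rewrite !mxE mderivX mevalZ mevalX eqxx /= mnm1E eq_sym.
have [->|] := eqVneq j l; last by rewrite mul0r.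
rewrite mul1r big1 // => i _.
by rewrite mnmBE subnn expr0.
Qed.

Lemma gradient_sum a (I : Type) (r : seq I) (F : I -> {mpoly k[M]}) :
  gradient a (\sum_(i <- r) F i) = \sum_(i <- r) gradient a (F i).
Proof.
elim: r => [|i r IH]; first by rewrite !big_nil -mpolyC0 gradientC.
by rewrite !big_cons gradientD IH.
Qed.

Lemma gradient_hadamard a (h : 'I_M -> {mpoly k[M]}) c :
  gradient a (c%:MP + \sum_l h l * ('X_l - (a l)%:MP)) = \row_l (h l).@[a].
Proof.
rewrite gradientD gradientC add0r gradient_sum.
rewrite [RHS]row_sum_delta; apply: eq_bigr => l _.
rewrite gradientM mevalB mevalXU mevalC subrr scale0r add0r mxE.
by rewrite -mpolyCN gradientD gradientC addr0 gradientX.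
Qed.

End FirstOrder.

(** * Smooth points of hypersurfaces are regular *)

(** [H x c] stands for the coefficient of degree c of the image of x under a ring
morphism from A to the power series over D. *)
Section SeriesKernel.
Variables (A : comNzRingType) (D : idomainType) (H : A -> nat -> D).
Hypothesis HD : forall x y c, H (x + y) c = H x c + H y c.
Hypothesis H1 : H 1 0 != 0.
Hypothesis HM : forall x y c, H (x * y) c = \sum_(i < c.+1) H x i * H y (c - i)%N.

Definition series_kernel : {pred A} :=
  fun x => if excluded_middle_informative (forall c, H x c = 0) then true else false.

Lemma series_kernelP x : reflect (forall c, H x c = 0) (x \in series_kernel).
Proof.
rewrite unfold_in /series_kernel.
by case: excluded_middle_informative => h; constructor.
Qed.

(** The lowest coefficients of two nonzero series have a nonzero product. *)
Lemma series_kernel_prime : prime_ideal series_kernel.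
Proof.
split; first split.
- apply/series_kernelP => c; have /eqP := HD 0 0 c.
  by rewrite addr0 -subr_eq subrr eq_sym => /eqP.
- by apply/series_kernelP => /(_ 0%N)/eqP; rewrite (negPf H1).
- move=> a u v /series_kernelP hu /series_kernelP hv; apply/series_kernelP => c.
  by rewrite HD hv addr0 HM big1 // => i _; rewrite hu mulr0.
move=> u v /series_kernelP huv; apply/orP.
have first_coef w : w \notin series_kernel ->
    exists2 i, H w i != 0 & forall j, (j < i)%N -> H w j = 0.
  move=> nw; have [i0 wi0] : exists i, H w i != 0.
    apply: NNPP => nex; case/negP: nw; apply/series_kernelP => c.
    by apply/eqP; apply: contraT => h; case: nex; exists c.
  have ex : exists i, H w i != 0 by exists i0.
  exists (ex_minn ex); first by case: ex_minnP.
  by move=> j; case: ex_minnP => m _ hm; apply: contraTeq => /hm; rewrite -leqNgt.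
case: (boolP (u \in series_kernel)); [by left|move=> /first_coef[a ua hua]].
case: (boolP (v \in series_kernel)); [by right|move=> /first_coef[b vb hvb]].
have := huv (a + b)%N; rewrite HM (bigD1 (inord a)) //= inordK; last by rewrite ltnS leq_addr.
rewrite addKn big1 ?addr0 => [/eqP|i]; first by rewrite mulf_eq0 (negPf ua) (negPf vb).
rewrite -val_eqE /= inordK; last by rewrite ltnS leq_addr.
rewrite neq_ltn => /orP[/hua->|ai]; first by rewrite mul0r.
by rewrite hvb ?mulr0 //; have := ltn_ord i; lia.
Qed.

End SeriesKernel.

Lemma mem_point_ideal (k : fieldType) (N : nat) (a : 'I_N -> k) (g : {mpoly k[N]}) :
  (g \in point_ideal a) = (g.@[a] == 0).
Proof. by []. Qed.

Section PolynomialRingDimension.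
Variables (k : fieldType) (M : nat).
Local Notation A := {mpoly k[M]}.

Lemma zero_ideal_prime : prime_ideal (fun x : A => x == 0).
Proof.
split; first split; rewrite ?unfold_in ?eqxx ?oner_eq0 //.
  by move=> a u v; rewrite !unfold_in => /eqP-> /eqP->; rewrite mulr0 addr0.
by move=> u v; rewrite !unfold_in mulf_eq0.
Qed.

(** The polynomial ring in M variables has O(s^M) monomials of degree at most s. *)
Lemma zero_chain_bound (e : nat) (Q : nat -> {pred A}) :
  (forall i, (i <= e)%N -> prime_ideal (Q i)) ->
  (forall i, (i < e)%N -> {subset Q i <= Q i.+1} /\ ~ {subset Q i.+1 <= Q i}) ->
  (forall x, (x \in Q 0%N) = (x == 0)) -> (e <= M)%N.
Proof.
move=> prQ chQ Q0.
apply: (@chain_bound k M e M 1 Q A idfun prQ chQ) => //.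
  by move=> x y /eqP; rewrite mulf_eq0 => /orP[] /eqP; [left|right].
move=> s; exists {ffun 'I_M -> 'I_s.+1},
  (fun g : {ffun 'I_M -> 'I_s.+1} => 'X_[[multinom (g i : nat) | i < M]]), 1.
split; first exact/eqP/oner_neq0.
  by rewrite card_ffun !card_ord mul1n.
move=> m ms; pose g0 : {ffun 'I_M -> 'I_s.+1} := [ffun i => inord (m i)].
exists (fun g => (g == g0)%:R); rewrite mul1r (bigD1 g0) //= eqxx mul1r.
rewrite big1 => [|g /negPf->]; last by rewrite mpolyC0 mul0r.
rewrite addr0; congr 'X_[_]; apply/mnmP => i; rewrite mnmE ffunE inordK // ltnS.
by apply: leq_trans ms; rewrite mdegE (bigD1 i) //= leq_addr.
Qed.

End PolynomialRingDimension.

Section Truncation.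
Variable D : comNzRingType.
Implicit Types x y : {poly D}.

Definition small (N : nat) x := exists q, x = q * 'X^N.

Lemma small0 N : small N 0. Proof. by exists 0; rewrite mul0r. Qed.
Lemma smallD N x y : small N x -> small N y -> small N (x + y).
Proof. by case=> p -> [q ->]; exists (p + q); rewrite mulrDl. Qed.
Lemma smallMl N x y : small N y -> small N (x * y).
Proof. by case=> q ->; exists (x * q); rewrite mulrA. Qed.
Lemma smallN N x : small N x -> small N (- x).
Proof. by rewrite -mulN1r; apply: smallMl. Qed.
Lemma smallM N N' x y : small N x -> small N' y -> small (N + N') (x * y).
Proof. by case=> p -> [q ->]; exists (p * q); rewrite exprD; ring. Qed.
Lemma small_le N N' x : (N <= N')%N -> small N' x -> small N x.
Proof.
move=> le [q ->]; exists (q * 'X^(N' - N)); rewrite -mulrA -exprD subnK //.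
Qed.
Lemma small_coef N x c : small N x -> (c < N)%N -> x`_c = 0.
Proof. by case=> q -> lt; rewrite coefMXn lt. Qed.
Lemma small_sum N (I : finType) (F : I -> {poly D}) :
  (forall i, small N (F i)) -> small N (\sum_i F i).
Proof. by move=> h; elim/big_ind: _ => //; [exact: small0 | exact: smallD]. Qed.

End Truncation.

(** Here f vanishes at b and its partial derivative kappa along the coordinate l0
is nonzero there. A formal parametrization of f = 0 over D = k[X_0, ..., X_(r-1)]
is built in the variable T of {poly D}: the coordinate lift l0 j is b + X_j T,
and the coordinate l0 is b + psi, where psi is approximated modulo every power
of T. Substituting X_j T rather than a power series variable reduces series in r
variables to series in one variable. *)
Section SmoothPoint.
Variables (k : fieldType) (r : nat).
Local Notation A := {mpoly k[r.+1]}.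
Local Notation D := {mpoly k[r]}.
Variables (b : 'I_r.+1 -> k) (l0 : 'I_r.+1) (h : 'I_r.+1 -> A).
Let f : A := \sum_l h l * ('X_l - (b l)%:MP).
Let kappa := (h l0).@[b].
Hypothesis kappa0 : kappa != 0.

Variable iota : {rmorphism k -> {poly D}}.
Hypothesis iotaE : forall c, iota c = (c%:MP)%:P.

Definition curve_point (psi : {poly D}) (l : 'I_r.+1) : {poly D} :=
  iota (b l) + (if unlift l0 l is Some j then ('X_j)%:P * 'X else psi).

Definition along (psi : {poly D}) : {rmorphism A -> {poly D}} :=
  mmap iota (curve_point psi).

Lemma mmapM (Y : 'I_r.+1 -> {poly D}) : {morph mmap iota Y : x y / x * y}.
Proof. by move=> x y; rewrite (rmorphM (mmap iota Y)). Qed.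

Lemma mmap_congr N (Y Y' : 'I_r.+1 -> {poly D}) (g : A) :
  (forall l, small N (Y l - Y' l)) -> small N (mmap iota Y g - mmap iota Y' g).
Proof.
move=> YY'; elim/mpoly_ring_ind: g => [c|i|x y hx hy|x y hx hy].
- by rewrite !mmapC subrr; exact: small0.
- by rewrite !mmapX !mmap1U.
- by rewrite !mmapD opprD addrACA; exact: smallD.
- rewrite !mmapM.
  set x1 := mmap _ _ _ in hx *; set x2 := mmap _ _ x in hx *.
  set y1 := mmap _ _ y in hy *; set y2 := mmap _ _ y in hy *.
  have -> : x1 * y1 - x2 * y2 = x1 * (y1 - y2) + y2 * (x1 - x2) by ring.
  by apply: smallD; apply: smallMl.
Qed.

Lemma along_congr N psi psi' g :
  small N (psi - psi') -> small N (along psi g - along psi' g).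
Proof.
move=> hpsi; apply: mmap_congr => l; rewrite /curve_point opprD addrACA subrr add0r.
by case: unliftP => [j _|_] //; rewrite subrr; exact: small0.
Qed.

Lemma along_const psi g : small 1 psi -> small 1 (along psi g - iota g.@[b]).
Proof.
move=> hpsi; have -> : iota g.@[b] = mmap iota (fun l => iota (b l)) g.
  elim/mpoly_ring_ind: g => [c|i|x y hx hy|x y hx hy].
  - by rewrite mevalC mmapC.
  - by rewrite mevalXU mmapX mmap1U.
  - by rewrite mevalD mmapD -hx -hy (rmorphD iota).
  - by rewrite mevalM mmapM -hx -hy (rmorphM iota).
apply: mmap_congr => l; rewrite /curve_point addrC addKr.
by case: unliftP => [j _|_] //; exists ('X_j)%:P; rewrite expr1.
Qed.

(** Expanding f by [h], the equation f = 0 along the curve reads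
psi = newton psi, where the factor of psi on the right is divisible by T; this
makes [newton] contracting for the T-adic topology. *)
Definition newton (psi : {poly D}) : {poly D} :=
  - (iota kappa^-1 * (\sum_(j < r) along psi (h (lift l0 j)) * (('X_j)%:P * 'X)
     + (along psi (h l0) - iota kappa) * psi)).

Definition approx (N : nat) : {poly D} := iter N newton 0.

Lemma approx_small N : small 1 (approx N).
Proof.
case: N => [|N]; first exact: small0.
rewrite /approx iterS -/(approx N); elim: N => [|N IH].
all: apply: smallN; apply: smallMl; apply: smallD.
1,3: by apply: small_sum => j; apply: smallMl; exists ('X_j)%:P; rewrite expr1.
all: apply: smallMl.
- exact: small0.
- by rewrite /approx iterS -/(approx N).
Qed.

Lemma approx_step N : small N.+1 (approx N.+1 - approx N).
Proof.
elim: N => [|N IH]; first by rewrite subr0; exact: approx_small.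
set p1 := approx N.+1 in IH *; set p0 := approx N in IH *.
have -> : approx N.+2 = newton p1 by [].
have {2}-> : p1 = newton p0 by [].
rewrite /newton opprK addrC -mulrBr; apply: smallMl.
set S0 := \sum_j _; set S1 := \sum_j _.
have -> : S0 + (along p0 (h l0) - iota kappa) * p0
    - (S1 + (along p1 (h l0) - iota kappa) * p1) =
  - ((S1 - S0) + (along p1 (h l0) - along p0 (h l0)) * p1
    + (along p0 (h l0) - iota kappa) * (p1 - p0)) by ring.
apply: smallN; apply: smallD; first apply: smallD.
- rewrite -sumrB; apply: small_sum => j; rewrite -mulrBl -addn1; apply: smallM.
    exact: along_congr.
  by exists ('X_j)%:P; rewrite expr1.
- rewrite -addn1; apply: smallM; last exact: approx_small.
  exact: along_congr.
- rewrite -add1n; apply: smallM => //; apply: along_const; exact: approx_small.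
Qed.

Lemma approx_le N N' : (N <= N')%N -> small N.+1 (approx N' - approx N).
Proof.
move=> /subnK<-; elim: (N' - N)%N => [|d IH]; first by rewrite subrr; exact: small0.
rewrite addSn -[X in X - _](subrK (approx (d + N))) -addrA; apply: smallD => //.
apply: small_le (approx_step _); lia.
Qed.

(** Along the N-th approximation, f is kappa times the difference between that
approximation and the next one. *)
Lemma along_root N : small N.+1 (along (approx N) f).
Proof.
have -> : along (approx N) f = iota kappa * - (approx N.+1 - approx N).
  rewrite /f (rmorph_sum (along (approx N))) (bigD1_ord l0) //=.
  have E l : mmap iota (curve_point (approx N)) (h l * ('X_l - (b l)%:MP)) =
     along (approx N) (h l) * (if unlift l0 l is Some j then ('X_j)%:P * 'X else approx N).
    by rewrite mmapM mmapB mmapC mmapX mmap1U /curve_point addrC addKr.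
  rewrite E unlift_none; under eq_bigr do rewrite E liftK.
  rewrite -/(approx N) /newton; set S := \sum_j _; set a := along _ _.
  rewrite opprD opprK mulrDr mulrA -(rmorphM iota) mulfV // (rmorph1 iota) mul1r; ring.
by apply: smallMl; apply: smallN; exact: approx_step.
Qed.

(** Coefficients along the limit of the approximations: the one of degree c is
already exact for [approx c]. *)
Definition series (g : A) (c : nat) : D := (along (approx c) g)`_c.

Lemma seriesE N g c : (c <= N)%N -> (along (approx N) g)`_c = series g c.
Proof.
move=> cN; apply/eqP; rewrite -subr_eq0 /series -coefB; apply/eqP.
by apply: (@small_coef _ c.+1) => //; apply: along_congr; exact: approx_le.
Qed.

Lemma seriesD x y c : series (x + y) c = series x c + series y c.
Proof. by rewrite /series /= mmapD coefD. Qed.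

Lemma seriesM x y c : series (x * y) c = \sum_(i < c.+1) series x i * series y (c - i).
Proof.
rewrite {1}/series /= mmapM coefM; apply: eq_bigr => i _.
by rewrite !seriesE ?leq_subr // -ltnS.
Qed.

Lemma series0 g : series g 0 = (g.@[b])%:MP.
Proof.
have := small_coef (along_const g (small0 _ 1)) (ltnSn 0).
by rewrite coefB /series iotaE coefC eqxx => /eqP; rewrite subr_eq0 => /eqP.
Qed.

Lemma series_root c : series f c = 0.
Proof. by apply: (small_coef (along_root c)). Qed.

Lemma series_coord (i : 'I_r) c :
  series ('X_(lift l0 i) - (b (lift l0 i))%:MP) c = (c == 1)%:R * 'X_i.
Proof.
rewrite /series /= mmapB mmapC mmapX mmap1U /curve_point addrC addKr liftK.
by rewrite coefMX coefC; case: c => [|[|c]]; rewrite ?mul0r ?mul1r.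
Qed.

Definition kill (i : nat) : {rmorphism D -> D} :=
  comp_mpoly [tuple (if (j < i)%N then 0 else 'X_j) | j < r].

Lemma killX i (j : 'I_r) : kill i 'X_j = if (j < i)%N then 0 else 'X_j.
Proof. by rewrite /kill /= comp_mpolyXU -tnth_nth tnth_mktuple. Qed.

Lemma killC i c : kill i c%:MP = c%:MP.
Proof. exact: comp_mpolyC. Qed.

Lemma kill_kill i j x : (i <= j)%N -> kill j (kill i x) = kill j x.
Proof.
move=> ij; elim/mpoly_ring_ind: x => [c|l|x y hx hy|x y hx hy].
- by rewrite !killC.
- by rewrite !killX; case: ltnP => li; rewrite ?rmorph0 ?killX // (leq_trans li ij).
- by rewrite !(rmorphD (kill _)) hx hy.
- by rewrite !(rmorphM (kill _)) hx hy.
Qed.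

(** The functions vanishing on the part of the formal hypersurface f = 0 where
its first i parameters vanish. *)
Definition arc_ideal (i : nat) := series_kernel (fun g c => kill i (series g c)).

Lemma arc_idealP i g : reflect (forall c, kill i (series g c) = 0) (g \in arc_ideal i).
Proof. exact: series_kernelP. Qed.

Lemma arc_ideal_prime i : prime_ideal (arc_ideal i).
Proof.
apply: series_kernel_prime => [x y c||x y c].
- by rewrite seriesD rmorphD.
- by rewrite series0 meval1 killC mpolyC_eq0 oner_neq0.
- by rewrite seriesM rmorph_sum; apply: eq_bigr => j _; rewrite rmorphM.
Qed.

(** The i-th and j-th arc ideals are separated, for i < j, by the
coordinate whose expansion is X_i T. *)
Lemma smooth_chain : loc_prime_chain (fun g => g = f) (point_ideal b) r.
Proof.
exists (fun i => arc_ideal i); split.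
- by move=> i; exact: arc_ideal_prime.
- by move=> g ->; apply/arc_idealP => c; rewrite series_root rmorph0.
- move=> g /arc_idealP/(_ 0%N)/eqP.
  by rewrite series0 killC mpolyC_eq0.
move=> i j ij; split.
  move=> g /arc_idealP hg; apply/arc_idealP => c.
  by rewrite -(kill_kill _ (ltnW ij)) hg rmorph0.
have ir : (i < r)%N by apply: leq_trans ij _; rewrite -ltnS.
set w := 'X_(lift l0 (Ordinal ir)) - (b (lift l0 (Ordinal ir)))%:MP.
have wj : w \in arc_ideal j.
  by apply/arc_idealP => c; rewrite series_coord rmorphM killX /= ij mulr0.
move/(_ w wj)/arc_idealP/(_ 1%N)/eqP.
by rewrite series_coord mul1r killX /= ltnn -msize_poly_eq0 msizeX.
Qed.

(** The zero ideal, put in front of a chain whose members contain f, gives a chain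
one step longer in a polynomial ring in r + 1 variables. *)
Lemma smooth_dim : f != 0 -> loc_krull_dim (fun g => g = f) (point_ideal b) r.
Proof.
move=> f0; split; first exact: smooth_chain.
move=> e [P [prP fP _ chP]].
pose Q (i : nat) : {pred A} := if i is i'.+1 then P (inord i') else fun x => x == 0.
suff : (e.+1 <= r.+1)%N by [].
apply: (@zero_chain_bound k r.+1 e.+1 Q) => //.
  by case=> [|i] _; [exact: zero_ideal_prime | exact: prP].
case=> [|i] ie /=.
  split=> [x|/(_ f)]; first by rewrite unfold_in => /eqP->; apply: prime_mem0.
  have -> : inord 0 = ord0 :> 'I_e.+1 by apply: val_inj; rewrite /= inordK.
  by move/(_ (fP _ erefl)); rewrite unfold_in (negPf f0).
by apply: chP; rewrite !inordK // ltnW.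
Qed.

(** Modulo f, the coordinate l0 becomes a combination of the others after
multiplication by h l0, which is nonzero at b. *)
Lemma smooth_max_gen : loc_max_ideal_gen (fun g => g = f) (point_ideal b) r.
Proof.
exists (fun i => 'X_(lift l0 i) - (b (lift l0 i))%:MP); split.
  by move=> i; rewrite mem_point_ideal mevalB mevalXU mevalC subrr.
move=> g; rewrite mem_point_ideal => /eqP g0; have [u] := hadamard b g.
rewrite g0 mpolyC0 add0r => ->.
exists (h l0), (fun i => h l0 * u (lift l0 i) - u l0 * h (lift l0 i)); split => //.
exists 1%N, (fun _ => u l0), (fun _ => f); split => //.
rewrite big_ord1 /f !(bigD1_ord l0) //= !mulrDr.
set s1 := \sum_i _; set s2 := \sum_i _; set s3 := \sum_i _.
have -> : s2 = h l0 * s1 - u l0 * s3; last by ring.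
by rewrite !mulr_sumr -sumrB; apply: eq_bigr => i _; ring.
Qed.

End SmoothPoint.

(** Jacobian criterion at a rational point of a hypersurface. *)
Theorem smooth_regular (k : fieldType) (r : nat) (f : {mpoly k[r.+1]})
    (b : 'I_r.+1 -> k) :
  f.@[b] = 0 -> gradient b f != 0 ->
  loc_regular (fun g => g = f) (point_ideal b).
Proof.
move=> f0 grad0; have [h] := hadamard b f; rewrite f0 => fE.
have gradE : gradient b f = \row_l (h l).@[b] by rewrite {1}fE gradient_hadamard.
have fn0 : f != 0 by apply: contraNneq grad0 => ->; rewrite -mpolyC0 gradientC.
have [l0 hl0] : exists l, (h l).@[b] != 0.
  apply: NNPP => nex; case/negP: grad0; rewrite gradE; apply/eqP/rowP => l.
  by rewrite !mxE; apply/eqP; apply: contraT => hl; case: nex; exists l.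
move: fE fn0; rewrite mpolyC0 add0r => -> fn0.
pose iota : {rmorphism k -> {poly {mpoly k[r]}}} := polyC \o @mpolyC r k.
by exists r; split; [exact: (smooth_dim hl0 (iota := iota)) | exact: smooth_max_gen hl0].
Qed.

(** * Counting on the incidence variety of a form and n of its zeros *)

Section Weight.
Variable d : nat.

(** Digits in base d + 1: exponent vectors with entries at most d are separated
by their weights. Leading terms are taken for an integer weight rather than for a
monomial order so that the number of division steps is linear in the degree. *)
Definition weight (n : nat) (beta : 'I_n -> nat) : nat :=
  (\sum_(l < n) d.+1 ^ l * beta l)%N.

Lemma weightS n (beta : 'I_n.+1 -> nat) :
  weight beta = (beta ord0 + d.+1 * weight (fun l => beta (lift ord0 l)))%N.
Proof.
rewrite /weight big_ord_recl expn0 mul1n big_distrr /=; congr (_ + _)%N.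
by apply: eq_bigr => l _; rewrite mulnA -expnS.
Qed.

Lemma weight_inj n (beta beta' : 'I_n -> nat) :
  (forall l, (beta l <= d)%N) -> (forall l, (beta' l <= d)%N) ->
  weight beta = weight beta' -> beta =1 beta'.
Proof.
elim: n beta beta' => [|n IH] beta beta' hb hb'; first by move=> _ [].
rewrite !weightS => E.
have E0 : beta ord0 = beta' ord0.
  have := congr1 (modn^~ d.+1) E.
  by rewrite ![(_ + d.+1 * _)%N]addnC ![(d.+1 * _)%N]mulnC !modnMDl !modn_small ?ltnS.
move: E; rewrite E0 => /addnI /eqP; rewrite eqn_pmul2l // => /eqP E l.
have [j ->|->] := unliftP ord0 l; last exact: E0.
exact: (IH _ _ (fun l => hb (lift ord0 l)) (fun l => hb' (lift ord0 l)) E).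
Qed.

Lemma weightD n (beta beta' : 'I_n -> nat) :
  weight (fun l => beta l + beta' l)%N = (weight beta + weight beta')%N.
Proof. by rewrite /weight -big_split; apply: eq_bigr => l _; rewrite mulnDr. Qed.

Lemma leq_weight n (beta : 'I_n -> nat) l : (beta l <= weight beta)%N.
Proof.
rewrite /weight (bigD1 l) //=; apply: leq_trans (leq_addr _ _).
by rewrite leq_pmull // expn_gt0.
Qed.

Lemma weight_le n (beta : 'I_n.+1 -> nat) :
  (weight beta <= d.+1 ^ n * \sum_l beta l)%N.
Proof.
rewrite big_distrr; apply: leq_sum => l _; rewrite leq_mul2r leq_pexp2l ?orbT //.
by rewrite -ltnS.
Qed.

End Weight.

Section Span.
Variables (k : fieldType) (B : comNzRingType) (iota : {rmorphism k -> B}).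

Definition in_span (J : finType) (b : J -> B) (x : B) : Prop :=
  exists lam : J -> k, x = \sum_j iota (lam j) * b j.

Lemma in_span0 (J : finType) (b : J -> B) : in_span b 0.
Proof. by exists (fun _ => 0); rewrite big1 // => j _; rewrite rmorph0 mul0r. Qed.

Lemma in_spanD (J : finType) (b : J -> B) x y :
  in_span b x -> in_span b y -> in_span b (x + y).
Proof.
move=> [l1 ->] [l2 ->]; exists (fun j => l1 j + l2 j); rewrite -big_split.
by apply: eq_bigr => j _; rewrite rmorphD mulrDl.
Qed.

Lemma in_spanZ (J : finType) (b : J -> B) c x :
  in_span b x -> in_span b (iota c * x).
Proof.
move=> [l1 ->]; exists (fun j => c * l1 j); rewrite mulr_sumr.
by apply: eq_bigr => j _; rewrite rmorphM mulrA.
Qed.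

Lemma in_span_mem (J : finType) (b : J -> B) j : in_span b (b j).
Proof.
exists (fun i => (i == j)%:R); rewrite (bigD1 j) //= eqxx rmorph1 mul1r.
by rewrite big1 ?addr0 // => i /negPf->; rewrite rmorph0 mul0r.
Qed.

Lemma in_span_sum (J : finType) (b : J -> B) (I : eqType) (s : seq I) (F : I -> B) :
  (forall i, i \in s -> in_span b (F i)) -> in_span b (\sum_(i <- s) F i).
Proof.
move=> h; rewrite big_seq; elim/big_ind: _ => //; [exact: in_span0 | exact: in_spanD].
Qed.

Section FormValues.
Variables (N : nat) (u : 'I_N -> B).

(** Graded by the degree and stable under products, so that the coefficients
produced in different blocks can be multiplied before they are counted. *)
Definition form_value (s : nat) (x : B) : Prop :=
  exists2 G : {mpoly k[N]}, G \is s.-homog & x = mmap iota u G.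

Lemma form_value0 s : form_value s 0.
Proof. by exists 0; [exact: dhomog0 | rewrite mmap0]. Qed.
Lemma form_valueD s x y : form_value s x -> form_value s y -> form_value s (x + y).
Proof.
by move=> [G hG ->] [G' hG' ->]; exists (G + G'); [exact: rpredD | rewrite mmapD].
Qed.
Lemma form_valueN s x : form_value s x -> form_value s (- x).
Proof. by move=> [G hG ->]; exists (- G); [rewrite rpredN | rewrite mmapN]. Qed.
Lemma form_valueM s t x y :
  form_value s x -> form_value t y -> form_value (s + t) (x * y).
Proof.
move=> [G hG ->] [G' hG' ->]; exists (G * G'); first exact: dhomogM.
by rewrite (rmorphM (mmap iota u)).
Qed.
Lemma form_value1 : form_value 0 1.
Proof. by exists 1; [exact: dhomog1 | rewrite (rmorph1 (mmap iota u))]. Qed.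
Lemma form_value_var a : form_value 1 (u a).
Proof. by exists 'X_a; [rewrite dhomogX; apply/eqP; exact: mdeg1 | rewrite mmapX mmap1U]. Qed.
Lemma form_valueX a s : form_value s (u a ^+ s).
Proof.
elim: s => [|s IH]; first exact: form_value1.
by rewrite exprS -add1n; apply: form_valueM => //; exact: form_value_var.
Qed.
Lemma form_value_prod n (s : nat) (F : 'I_n -> B) :
  (forall i, form_value s (F i)) -> form_value (n * s) (\prod_i F i).
Proof.
elim: n F => [|n IH] F hF; first by rewrite big_ord0; exact: form_value1.
by rewrite big_ord_recl mulSn; apply: form_valueM => //; apply: IH.
Qed.

End FormValues.

(** Monomials of degree s in N + 1 variables are determined by the exponents of
all variables but the first; hence an exponent N, and not N + 1, in the count. *)
Definition form_basis N (u : 'I_N.+1 -> B) (s : nat) (g : {ffun 'I_N -> 'I_s.+1}) : B :=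
  u ord0 ^+ (s - \sum_j g j) * \prod_j u (lift ord0 j) ^+ g j.

Lemma form_value_span N (u : 'I_N.+1 -> B) s x :
  form_value u s x -> in_span (@form_basis N u s) x.
Proof.
case=> G /dhomogP hG ->; apply: in_span_sum => m /hG ms; apply: in_spanZ.
have {}ms : mdeg m = s := ms.
rewrite /mmap1 big_ord_recl.
pose g : {ffun 'I_N -> 'I_s.+1} := [ffun j => inord (m (lift ord0 j))].
have gE j : g j = m (lift ord0 j) :> nat.
  rewrite ffunE inordK // ltnS -ms mdegE (bigD1 (lift ord0 j)) //=; exact: leq_addr.
have -> : m ord0 = (s - \sum_j g j)%N.
  by rewrite (eq_bigr _ (fun j _ => gE j)) -ms mdegE big_ord_recl addnK.
rewrite [X in _ * X](eq_bigr (fun j => u (lift ord0 j) ^+ g j)) => [|j _]; last by rewrite gE.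
exact: (in_span_mem (@form_basis N u s) g).
Qed.

End Span.

Section Reduction.
Variables (k : fieldType) (B : comNzRingType) (iota : {rmorphism k -> B}).
Variables (N r d : nat) (u : 'I_N -> B).

Definition monom (n : nat) (y : 'I_n -> B) (beta : 'I_n -> nat) : B :=
  \prod_l y l ^+ beta l.

Lemma monomD n (y : 'I_n -> B) beta beta' :
  monom y (fun l => beta l + beta' l)%N = monom y beta * monom y beta'.
Proof. by rewrite /monom -big_split; apply: eq_bigr => l _; rewrite exprD. Qed.

(** Indexes the monomials having some exponent below d, the other exponents
being at most S. A monomial that is not divisible by a given monomial with
exponents at most d is of this kind. *)
Definition reduced_index (S : nat) : finType :=
  ('I_r.+1 * 'I_d * {ffun 'I_r -> 'I_S.+1})%type.

Definition reduced_monom (y : 'I_r.+1 -> B) S (j : reduced_index S) : B :=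
  y j.1.1 ^+ j.1.2 * \prod_l y (lift j.1.1 l) ^+ j.2 l.

Definition reducible (y : 'I_r.+1 -> B) (S s : nat) (x : B) : Prop :=
  exists2 h : reduced_index S -> B,
    forall j, form_value iota u s (h j) & x = \sum_j h j * reduced_monom y j.

Section Block.
Variables (y : 'I_r.+1 -> B) (m : 'I_N -> 'I_r.+1 -> nat) (a0 : 'I_N).
Hypothesis rel : \sum_a u a * monom y (m a) = 0.
Hypothesis lead : forall a, a != a0 -> u a = 0 \/ (weight d (m a) < weight d (m a0))%N.
Hypothesis md : forall l, (m a0 l <= d)%N.

(** Division by the relation, whose leading term is u a0 times the monomial m a0:
each step uses up one factor u a0, brings in another u a and lowers the weight. *)
Lemma block_reduction S s beta : (s <= S)%N -> (weight d beta < s)%N ->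
  reducible y S s (u a0 ^+ s * monom y beta).
Proof.
elim: s beta => [//|s IH] beta sS ws.
case: (boolP [exists l, (beta l < m a0 l)%N]) => [/existsP[l hl]|/existsPn irr].
  have bd : (beta l < d)%N by apply: leq_trans hl (md l).
  pose j0 : reduced_index S := (l, Ordinal bd, [ffun i => inord (beta (lift l i))]).
  exists (fun j => if j == j0 then u a0 ^+ s.+1 else 0).
    by move=> j; case: ifP => _; [exact: form_valueX | exact: form_value0].
  rewrite (bigD1 j0) //= eqxx big1 => [|j /negPf->]; last by rewrite mul0r.
  rewrite addr0; congr (_ * _); rewrite /monom (bigD1_ord l) //=; congr (_ * _).
  apply: eq_bigr => i _; rewrite ffunE inordK // ltnS.
  by apply: leq_trans sS; apply: ltnW; apply: leq_ltn_trans (leq_weight d _ _) ws.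
(* The leading monomial divides: replace it by the other terms of the relation. *)
pose gamma l := (beta l - m a0 l)%N.
have betaE l : beta l = (m a0 l + gamma l)%N by rewrite subnKC // leqNgt.
have wE : weight d beta = (weight d (m a0) + weight d gamma)%N.
  by rewrite -weightD; apply: eq_bigr => l _; rewrite betaE.
have -> : u a0 ^+ s.+1 * monom y beta =
    - \sum_(a | a != a0) u a * (u a0 ^+ s * monom y (fun l => m a l + gamma l)%N).
  have -> : monom y beta = monom y (m a0) * monom y gamma.
    by rewrite -monomD; apply: eq_bigr => l _; rewrite betaE.
  have /eqP := rel; rewrite (bigD1 a0) //= addrC addr_eq0 => /eqP E.
  rewrite exprSr -mulrA mulrA -!mulrA [u a0 * _]mulrA -[u a0 * monom y (m a0)]opprK -E.
  rewrite mulNr mulrN mulr_suml mulr_sumr; congr (- _); apply: eq_bigr => a _.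
  by rewrite monomD; ring.
suff : forall a, a != a0 ->
    reducible y S s.+1 (u a * (u a0 ^+ s * monom y (fun l => m a l + gamma l)%N)).
  move=> h; suff [hh h1 ->] : reducible y S s.+1
      (\sum_(a | a != a0) u a * (u a0 ^+ s * monom y (fun l => m a l + gamma l)%N)).
    exists (fun j => - hh j); first by move=> j; apply: form_valueN.
    by rewrite -sumrN; apply: eq_bigr => j _; rewrite mulNr.
  elim/big_ind: _ => //.
    exists (fun _ => 0); first by move=> j; exact: form_value0.
    by rewrite big1 // => j _; rewrite mul0r.
  move=> _ _ [h1 p1 ->] [h2 p2 ->]; exists (fun j => h1 j + h2 j).
    by move=> j; apply: form_valueD.
  by rewrite -big_split; apply: eq_bigr => j _; rewrite mulrDl.
move=> a /lead[->|lt].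
  exists (fun _ => 0); first by move=> j; exact: form_value0.
  by rewrite mul0r big1 // => j _; rewrite mul0r.
have [||h p ->] := IH (fun l => m a l + gamma l)%N; first exact: ltnW.
  by rewrite weightD; move: ws; rewrite wE; lia.
exists (fun j => u a * h j).
  by move=> j; rewrite -add1n; apply: form_valueM => //; exact: form_value_var.
by rewrite mulr_sumr; apply: eq_bigr => j _; rewrite mulrA.
Qed.

End Block.
End Reduction.

Section Incidence.
Variables (k : fieldType) (B : comNzRingType) (iota : {rmorphism k -> B}).
Hypothesis domB : forall x y : B, x * y = 0 -> x = 0 \/ y = 0.
Variables (N r d n : nat) (u : 'I_N.+1 -> B) (y : 'I_n -> 'I_r.+1 -> B).
Variable m : 'I_n -> 'I_N.+1 -> 'I_r.+1 -> nat.
Hypothesis rel : forall i, \sum_a u a * monom (y i) (m i a) = 0.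
Hypothesis md : forall i a l, (m i a l <= d)%N.
Hypothesis m_inj : forall i a a', m i a =1 m i a' -> a = a'.
Hypothesis u_neq0 : exists a, u a != 0.

Let W := (d.+1 ^ r)%N.

Definition incidence_const : nat :=
  ((n * W.+1).+1 ^ N * (r.+1 * d * W.+2 ^ r) ^ n)%N.

(** Each of the n blocks of variables satisfies one nontrivial relation linear in
u, which removes one parameter per block, and u itself counts projectively. The
factor c is the product of the powers of the leading coefficients used by
[block_reduction] in the n blocks, so the coefficients of the reduced monomials
are forms in u of one common degree. *)
Lemma incidence_growth s : exists (J : finType) (b : J -> B) (c : B),
  [/\ c <> 0, (#|J| <= incidence_const * s.+1 ^ (N + n * r))%N &
   forall beta : 'I_n -> 'I_r.+1 -> nat, (forall i, \sum_l beta i l <= s)%N ->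
     in_span iota b (c * \prod_i monom (y i) (beta i))].
Proof.
have [a0 a0P] : exists a0 : 'I_n -> 'I_N.+1, forall i, u (a0 i) != 0 /\
    forall a, a != a0 i -> u a = 0 \/ (weight d (m i a) < weight d (m i (a0 i)))%N.
  apply: (@fin_all_exists _ (fun _ => 'I_N.+1) (fun i a0 => u a0 != 0 /\
    forall a, a != a0 -> u a = 0 \/ (weight d (m i a) < weight d (m i a0))%N)) => i.
  have [a1 ua1] := u_neq0.
  (* The leading term of the i-th relation, among the nonzero coefficients. *)
  pose a0 := [arg max_(a > a1 | u a != 0) weight d (m i a)]; exists a0.
  rewrite /a0; case: arg_maxnP => // {a0} a0 ua0 amax; split => // a ne.
  case: (eqVneq (u a) 0) => [->|ua]; [by left|right].
  rewrite ltn_neqAle; apply/andP; split; last exact: amax.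
  apply: contra ne => /eqP E.
  by apply/eqP/(m_inj (i := i))/(weight_inj (md _ _) (md _ _) E).
(* Monomials of degree at most s have weight at most W s, and one more unit
   keeps the weight strictly below the number S of division steps. *)
pose S := (W * s).+1.
pose J := ({ffun 'I_N -> 'I_(n * S).+1} * {ffun 'I_n -> reduced_index r d S})%type.
pose Y (g : {ffun 'I_n -> reduced_index r d S}) := \prod_i reduced_monom (y i) (g i).
pose b (j : J) := form_basis u j.1 * Y j.2.
exists J, b, (\prod_i u (a0 i) ^+ S); split.
- apply/eqP; elim/big_ind: _ => [|x x' hx hx'|i _]; first exact: oner_neq0.
    by apply/eqP => /domB[]/eqP; rewrite ?(negPf hx) ?(negPf hx').
  have [ua _] := a0P i; elim: (S) => [|S' IH]; first exact: oner_neq0.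
  by rewrite exprS; apply/eqP => /domB[]/eqP; rewrite ?(negPf ua) ?(negPf IH).
- rewrite card_prod !card_ffun !card_prod card_ffun !card_ord /incidence_const.
  rewrite expnD [(n * r)%N]mulnC expnM mulnACA -!expnMn; apply: leq_mul.
    have : ((n * S).+1 <= (n * W.+1).+1 * s.+1)%N by rewrite /S; nia.
    by move=> h; case: (N) => // N'; rewrite leq_exp2r.
  have h : (S.+1 <= W.+2 * s.+1)%N by rewrite /S; nia.
  case: (n) => // n'; rewrite leq_exp2r // -[X in (_ <= X)%N]mulnA -expnMn leq_mul2l.
  apply/orP; right.
  by case: (r) => // r'; rewrite leq_exp2r.
move=> beta hbeta; rewrite -big_split /=.
have [h hE] : exists h : 'I_n -> reduced_index r d S -> B, forall i,
    (forall j, form_value iota u S (h i j)) /\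
    u (a0 i) ^+ S * monom (y i) (beta i) = \sum_j h i j * reduced_monom (y i) j.
  apply: (@fin_all_exists _ (fun _ => reduced_index r d S -> B) (fun i h =>
    (forall j, form_value iota u S (h j)) /\
    u (a0 i) ^+ S * monom (y i) (beta i) = \sum_j h j * reduced_monom (y i) j)) => i.
  have [_ lead] := a0P i.
  have [||h h1 h2] := block_reduction iota (rel i) lead (md i _) (S := S) (s := S)
    (beta := beta i) => //; last by exists h.
  by rewrite ltnS; apply: leq_trans (weight_le _ _) _; rewrite leq_mul2l hbeta orbT.
rewrite (eq_bigr _ (fun i _ => proj2 (hE i))) bigA_distr_bigA /=.
apply: in_span_sum => g _; rewrite big_split /= -/(Y _).
have /form_value_span[lam ->] : form_value iota u (n * S) (\prod_i h i (g i)).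
  by apply: form_value_prod => i; exact: (proj1 (hE i)).
rewrite mulr_suml.
apply: in_span_sum => q _; rewrite -mulrA; apply: in_spanZ.
exact: (in_span_mem iota b (q, g)).
Qed.

End Incidence.

(** The form of [incidence_growth] for a number N of coefficients that is not
given as a successor. *)
Lemma incidence_growth_pred (k : fieldType) (B : comNzRingType) (iota : {rmorphism k -> B})
    (N r d n : nat) (u : 'I_N -> B) (y : 'I_n -> 'I_r.+1 -> B)
    (m : 'I_n -> 'I_N -> 'I_r.+1 -> nat) (s : nat) :
  (forall x y : B, x * y = 0 -> x = 0 \/ y = 0) ->
  (forall i, \sum_a u a * monom (y i) (m i a) = 0) ->
  (forall i a l, (m i a l <= d)%N) ->
  (forall i a a', m i a =1 m i a' -> a = a') ->
  (exists a, u a != 0) ->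
  exists (J : finType) (b : J -> B) (c : B),
  [/\ c <> 0, (#|J| <= incidence_const N.-1 r d n * s.+1 ^ (N.-1 + n * r))%N &
   forall beta : 'I_n -> 'I_r.+1 -> nat, (forall i, \sum_l beta i l <= s)%N ->
     in_span iota b (c * \prod_i monom (y i) (beta i))].
Proof.
case: N u m => [|N] u m domB rel md minj nz; first by case: nz => [[]].
exact: (incidence_growth _ domB rel md minj nz).
Qed.

(** * Forms and the Veronese matrix *)

Section Forms.
Variables (r d : nat).
Local Notation N := 'C(r + d, d).

Definition mon (a : 'I_N) : 'X_{1..r.+1} := nth 0%MM (monomials r d) a.

Lemma mdeg_mon a : mdeg (mon a) = d.
Proof. by apply/eqP; rewrite -mem_monomials mem_nth // size_monomials. Qed.

Lemma mon_inj : injective mon.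
Proof.
move=> a a' /eqP; rewrite nth_uniq ?size_monomials ?uniq_monomials // => /eqP.
exact: val_inj.
Qed.

Lemma monP (m : 'X_{1..r.+1}) : mdeg m = d -> exists a, m = mon a.
Proof.
move=> /eqP; rewrite -mem_monomials => /(nthP 0%MM)[i]; rewrite size_monomials => lt <-.
by exists (Ordinal lt).
Qed.

Lemma mon_le a c : (mon a c <= d)%N.
Proof. by rewrite -[X in (_ <= X)%N](mdeg_mon a) mdegE (bigD1 c) //= leq_addr. Qed.

Section Coefficients.
Variable k : fieldType.

Definition form (u : 'rV[k]_N) : {mpoly k[r.+1]} := \sum_a u 0 a *: 'X_[mon a].

Lemma mcoeff_form u a : (form u)@_(mon a) = u 0 a.
Proof.
rewrite raddf_sum (bigD1 a) //= mcoeffZ mcoeffX eqxx mulr1 big1 ?addr0 // => a' ne.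
by rewrite mcoeffZ mcoeffX (inj_eq mon_inj) (negPf ne) mulr0.
Qed.

Lemma form_homog u : form u \is d.-homog.
Proof.
apply: rpred_sum => a _; apply: rpredZ; rewrite dhomogX; apply/eqP; exact: mdeg_mon.
Qed.

Lemma homog_form (F : {mpoly k[r.+1]}) :
  F \is d.-homog -> F = form (\row_a F@_(mon a)).
Proof.
move=> hF; apply/mpolyP => m.
have [/monP[a ->]|md] := eqVneq (mdeg m) d; first by rewrite mcoeff_form mxE.
by rewrite (dhomog_nemf_coeff hF md) (dhomog_nemf_coeff (form_homog _) md).
Qed.

Lemma meval_form u x : (form u).@[x] = \sum_a u 0 a * \prod_c x c ^+ mon a c.
Proof. by rewrite rmorph_sum /=; apply: eq_bigr => a _; rewrite mevalZ mevalX. Qed.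

Lemma form_veronese n (u : 'rV[k]_N) (P : 'M[k]_(n, r.+1)) i :
  (u *m veronese_mx d P) 0 i = (form u).@[fun c => P i c].
Proof. by rewrite meval_form mxE; apply: eq_bigr => a _; rewrite mxE. Qed.

Lemma meval_homogZ (F : {mpoly k[r.+1]}) t (x : 'I_r.+1 -> k) : F \is d.-homog ->
  F.@[fun c => t * x c] = t ^+ d * F.@[x].
Proof.
move=> /homog_form->; rewrite !meval_form mulr_sumr; apply: eq_bigr => a _.
rewrite mulrCA; congr (_ * _); rewrite -(mdeg_mon a) mdegE -prodrXr -big_split.
by apply: eq_bigr => c _; rewrite exprMn.
Qed.

End Coefficients.

Lemma map_veronese (R S : comNzRingType) (f : {rmorphism R -> S}) n (P : 'M[R]_(n, r.+1)) :
  map_mx f (veronese_mx d P) = veronese_mx d (map_mx f P).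
Proof.
apply/matrixP => a i; rewrite !mxE rmorph_prod; apply: eq_bigr => c _.
by rewrite rmorphXn !mxE.
Qed.

End Forms.

(** Forms of degree d restricted to a linear subspace are forms of degree d in its
parameters. *)
Lemma veronese_factor (k : fieldType) (r d q n : nat) (L : 'M[k]_(q.+1, r.+1)) :
  exists W : 'M[k]_('C(r + d, d), 'C(q + d, d)),
  forall La : 'M[k]_(n, q.+1), veronese_mx d (La *m L) = W *m veronese_mx d La.
Proof.
pose G (a : 'I_('C(r + d, d))) : {mpoly k[q.+1]} :=
  \prod_c (\sum_e L e c *: 'X_e) ^+ mon a c.
have Ghom a : G a \is d.-homog.
  rewrite -(mdeg_mon a) mdegE; rewrite /G.
  elim/big_ind2: _ => [|x x' y y' hx hy|c _]; [exact: dhomog1|exact: dhomogM|].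
  rewrite -[X in X.-homog]mul1n; apply: dhomogMn; apply: rpred_sum => e _.
  by apply: rpredZ; rewrite dhomogX; apply/eqP; exact: mdeg1.
exists (\matrix_(a, e) (G a)@_(mon e)) => La; apply/matrixP => a i.
rewrite !mxE; transitivity (G a).@[fun e => La i e].
  rewrite rmorph_prod; apply: eq_bigr => c _; rewrite rmorphXn rmorph_sum !mxE /=.
  by congr (_ ^+ _); apply: eq_bigr => e _; rewrite mevalZ mevalXU mulrC.
rewrite {1}(homog_form (Ghom a)) meval_form; apply: eq_bigr => e _.
by rewrite !mxE.
Qed.

Section Secant.
Variables (k : fieldType) (r d n : nat) (P : 'M[k]_(n, r.+1)) (L : 'M[k]_(2, r.+1)).
Variable J : {set 'I_n}.
Hypotheses (cardJ : #|J| = d.+2) (JL : forall i, i \in J -> (row i P <= L)%MS).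

(** By [veronese_factor], the columns of the points on the line lie in a space of
dimension d + 1, one less than their number. *)
Lemma secant_relation : exists2 v : 'rV[k]_n, v != 0 &
  v *m (veronese_mx d P)^T = 0 /\ forall i, i \notin J -> v 0 i = 0.
Proof.
pose s (t : 'I_#|J|) : 'I_n := enum_val t.
have sP : (rowsub s P <= L)%MS.
  by apply/row_subP => t; rewrite row_rowsub JL // enum_valP.
have [La LaE] := submxP sP.
have [W WE] := @veronese_factor k r d 1 #|J| L.
have : kermx (veronese_mx d La)^T != 0.
  rewrite -mxrank_eq0 mxrank_ker subn_eq0 -ltnNge mxrank_tr.
  apply: leq_ltn_trans (rank_leq_row _) _.
  by rewrite cardJ add1n -[X in 'C(_, X)](addKn 1) add1n bin_sub // bin1.
case/rowV0Pn => w /sub_kermxP wL w0.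
exists (w *m rowsub s 1%:M); last split.
- case/rV0Pn: w0 => t wt; apply/rV0Pn; exists (s t).
  rewrite mxE (bigD1 t) //= !mxE eqxx mulr1 big1 ?addr0 // => t' ne.
  by rewrite !mxE (inj_eq enum_val_inj) (negPf ne) mulr0.
- rewrite -mulmxA -rowsubE.
  have -> : rowsub s (veronese_mx d P)^T = (veronese_mx d (rowsub s P))^T.
    by apply/matrixP => t a; rewrite !mxE; apply: eq_bigr => c _; rewrite mxE.
  by rewrite LaE WE trmx_mul mulmxA wL mul0mx.
move=> i iJ; rewrite mxE big1 // => t _; rewrite !mxE.
case: eqP => [E|_]; last by rewrite mulr0.
by rewrite -E enum_valP in iJ.
Qed.

End Secant.

(** * Matrices whose left kernel is a line *)

Section CorankOne.
Variables (k : fieldType) (N n : nat) (A : 'M[k]_(N, n)) (u : 'rV[k]_N).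
Hypotheses (u0 : u != 0) (uA : u *m A = 0).
Hypothesis uniq : forall v : 'rV[k]_N, v *m A = 0 -> exists c, v = c *: u.

Lemma corank1_rank : (\rank A).+1 = N.
Proof.
have keru : (kermx A :=: u)%MS.
  apply/eqmxP/andP; split; last exact/sub_kermxP.
  apply/row_subP => i; have /sub_kermxP/uniq[c ->] := row_sub i (kermx A).
  exact: scalemx_sub.
have := mxrank_ker A; rewrite keru rank_rV u0 /=; lia.
Qed.

(** Adjoining to A a basis vector e_a with u_a nonzero gives a matrix of
full rank. An invertible square submatrix must use the new column, since u
kills all columns of A, and its determinant is a cofactor of A. *)
Lemma corank1_cofactor : (N <= n)%N ->
  exists (s : 'I_N -> 'I_n) (a t : 'I_N), cofactor (colsub s A) a t != 0.
Proof.
move=> Nn; case/rV0Pn: (u0) => a ua.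
pose A1 : 'M[k]_(N, n + 1) := row_mx A (delta_mx a 0).
have A1full : row_full A1^T.
  rewrite /row_full mxrank_tr -/(row_free A1) -kermx_eq0.
  apply/rowV0P => v /sub_kermxP; rewrite mul_mx_row -row_mx0 => /eq_row_mx[/uniq[c ->]].
  move/matrixP/(_ 0 0); rewrite -colE !mxE => /eqP; rewrite mulf_eq0 (negPf ua) orbF.
  by move/eqP->; rewrite scale0r.
pose f := fullrankfun A1full.
have funit : colsub f A1 \in unitmx.
  rewrite -unitmx_tr.
  have -> : (colsub f A1)^T = rowsub f A1^T by apply/matrixP => i j; rewrite !mxE.
  exact: fullrowsub_unit.
have [t0 ft0] : exists t0, f t0 = rshift n 0.
  apply: NNPP => nex; case/eqP: u0.
  suff E : u *m colsub f A1 = 0 by rewrite -[u](mulmxK funit) E mul0mx.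
  apply/rowP => t; have -> : u *m colsub f A1 = colsub f (u *m A1).
    by rewrite mxsub_mul; congr (_ *m _); apply/matrixP => i j; rewrite !mxE.
  rewrite mul_mx_row uA mxE; case: (split_ordP (f t)) => [i ->|i E].
    by rewrite row_mxEl !mxE.
  by case: nex; exists t; rewrite E; congr (rshift n _); rewrite ord1.
pose s t : 'I_n := if split (f t) is inl i then i else widen_ord Nn a.
exists s, a, t0.
have sE t : t != t0 -> f t = lshift 1 (s t).
  move=> ne; rewrite /s; case: (split_ordP (f t)) => [i ->|i E]; last first.
    case/eqP: ne; apply: (@fullrankfun_inj _ _ _ _ A1full).
    by rewrite -/f ft0 E; congr (rshift n _); rewrite ord1.
  by [].
have : \det (colsub f A1) != 0 by rewrite -unitfE -unitmxE.
apply: contraNneq => cof0.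
apply/eqP; rewrite (expand_det_col _ t0) (bigD1 a) //= [X in _ + X]big1 => [|b ne].
  rewrite mxE ft0 row_mxEr mxE !eqxx mul1r addr0 -[RHS]cof0 /cofactor.
  congr (_ * \det _); apply/matrixP => i j.
  have -> : row' a (col' t0 (colsub f A1)) i j = A1 (lift a i) (f (lift t0 j)).
    by rewrite 3!mxE.
  by rewrite sE ?row_mxEl ?mxE // eq_sym neq_lift.
by rewrite mxE ft0 row_mxEr mxE (negPf ne) mul0r.
Qed.

End CorankOne.

(** * Tangent space and dimension of the configuration scheme *)

(** Differentiating at a the relations that express the coordinate functions by the
generators of the maximal ideal: the differentials of the e generators and of
the equations span the cotangent space of the affine space. *)
Lemma embedding_dim (k : fieldType) (M q e : nat) (G : {mpoly k[M]} -> Prop)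
    (a : 'I_M -> k) (T : 'M[k]_(q, M)) :
  (forall g, G g -> g.@[a] = 0 /\ (gradient a g <= T)%MS) ->
  loc_max_ideal_gen G (point_ideal a) e -> (M <= e + \rank T)%N.
Proof.
move=> hG [x [xm gen]].
pose X := \matrix_i gradient a (x i).
suff sub1 : (1%:M <= X + T)%MS.
  rewrite -[X in (X <= _)%N](mxrank1 k M); apply: leq_trans (mxrankS sub1) _.
  by apply: leq_trans (mxrank_adds_leqif _ _) _; rewrite leq_add2r rank_leq_row.
apply/row_subP => l; rewrite row1.
have [|s [c [sm [q' [c' [g [gG E]]]]]]] := gen ('X_l - (a l)%:MP).
  by rewrite mem_point_ideal mevalB mevalXU mevalC subrr.
rewrite mem_point_ideal in sm.
rewrite -(eqmx_scale _ sm).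
have -> : s.@[a] *: delta_mx 0 l =
   \sum_(i < e) (c i).@[a] *: gradient a (x i) + \sum_(i < q') (c' i).@[a] *: gradient a (g i).
  have := congr1 (gradient a) (canRL (subrK _) E).
  rewrite gradientD !gradient_sum gradientM -mpolyCN gradientD gradientC addr0 gradientX.
  rewrite mevalD mevalXU mevalC subrr scale0r add0r => ->; rewrite addrC.
  congr (_ + _); apply: eq_bigr => i _; rewrite gradientM.
    by have /eqP-> := xm i; rewrite scale0r add0r.
  by have [-> _] := hG _ (gG i); rewrite scale0r add0r.
apply: addmx_sub_adds; apply: summx_sub => i _; apply: scalemx_sub.
  by rewrite -(rowK (fun i => gradient a (x i)) i) row_sub.
by have [_ ->] := hG _ (gG i).
Qed.

Section Chart.
Variables (k : fieldType) (r d n : nat) (j : 'I_n -> 'I_r.+1) (p : 'M[k]_(n, r.+1)).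
Hypothesis pj : forall i, p i (j i) != 0.
Local Notation A := {mpoly k[n * r]}.
Local Notation N := 'C(r + d, d).
Local Notation A0 := (configuration_coord j p).
Local Notation Y := (chart_configuration k j).
Local Notation V := (veronese_mx d Y).

Lemma coordE i l : A0 (mxvec_index i l) = chart_coord (j i) (row i p) l.
Proof. by rewrite /configuration_coord mxvecE mxE. Qed.

(** The homogeneous coordinates of p scaled to the chart j. *)
Definition normalized : 'M[k]_(n, r.+1) := map_mx (meval A0) Y.
Local Notation p' := normalized.
Local Notation M0 := (veronese_mx d p').

Lemma normalized_chart i c :
  p' i c = chart_point (j i) (chart_coord (j i) (row i p)) 0 c.
Proof.
rewrite !mxE; case: unliftP => [l _|_]; last by rewrite meval1.
by rewrite mevalXU coordE.
Qed.

Lemma normalizedE i c : p' i c = (p i (j i))^-1 * p i c.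
Proof.
rewrite normalized_chart mxE; case: unliftP => [l ->|->].
  by rewrite /chart_coord !mxE mulrC.
by rewrite mulVf.
Qed.

Lemma map_V : map_mx (meval A0) V = M0.
Proof. exact: map_veronese. Qed.

Lemma meval_V a i : (V a i).@[A0] = M0 a i.
Proof. by rewrite -map_V [RHS]mxE. Qed.

Lemma veronese_chart a i :
  V a i = \prod_l 'X_(mxvec_index i l) ^+ mon a (lift (j i) l).
Proof.
rewrite mxE (bigD1_ord (j i)) //= !mxE unlift_none expr1n mul1r.
by apply: eq_bigr => l _; rewrite !mxE liftK.
Qed.

(** The equation, on the chart, for the i-th point to lie on the hypersurface with
coefficients u. *)
Definition local_equation (u : 'rV[k]_N) (i : 'I_n) : A :=
  \sum_a (u 0 a)%:MP * V a i.

Lemma meval_local_equation u i : (local_equation u i).@[A0] = (u *m M0) 0 i.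
Proof.
rewrite rmorph_sum mxE; apply: eq_bigr => a _ /=.
by rewrite mevalM mevalC meval_V.
Qed.

Lemma dehomogenize_form (u : 'rV[k]_N) (c : 'I_r.+1) :
  dehomogenize c (form u) = \sum_a u 0 a *: \prod_l 'X_l ^+ mon a (lift c l).
Proof.
rewrite /dehomogenize rmorph_sum; apply: eq_bigr => a _ /=.
rewrite comp_mpolyZ comp_mpolyX (bigD1_ord c) //= !tnth_mktuple mxE unlift_none.
rewrite expr1n mul1r; congr (_ *: _); apply: eq_bigr => l _.
by rewrite tnth_mktuple mxE liftK.
Qed.

(** [local_equation u i] is the dehomogenized form in the i-th block of variables.
Its first-order expansion is transported to the block, which avoids the chain
rule. *)
Lemma local_equation_gradient0 u i :
  let f := dehomogenize (j i) (form u) in let b := chart_coord (j i) (row i p) in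
  f.@[b] = 0 -> gradient b f = 0 -> gradient A0 (local_equation u i) = 0.
Proof.
move=> f b f0 grad0; have [h fE] := hadamard b f.
rewrite f0 in fE.
have hb l : (h l).@[b] = 0.
  have := gradient_hadamard b h 0; rewrite -fE grad0 => /rowP/(_ l).
  by rewrite !mxE.
pose sigma : {rmorphism {mpoly k[r]} -> A} :=
  comp_mpoly [tuple 'X_(mxvec_index i l) | l < r].
have sX l : sigma 'X_l = 'X_(mxvec_index i l).
  by rewrite /sigma /= comp_mpolyXU -tnth_nth tnth_mktuple.
have sC c : sigma c%:MP = c%:MP by exact: comp_mpolyC.
have sev g : (sigma g).@[A0] = g.@[b].
  rewrite /sigma /= comp_mpoly_meval; apply: meval_eq => l.
  by rewrite tnth_mktuple mevalXU coordE.
have -> : local_equation u i = sigma f.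
  rewrite /f dehomogenize_form (rmorph_sum sigma); apply: eq_bigr => a _.
  rewrite -mul_mpolyC (rmorphM sigma) sC veronese_chart (rmorph_prod sigma).
  by congr (_ * _); apply: eq_bigr => l _; rewrite (rmorphXn sigma) sX.
rewrite fE mpolyC0 add0r (rmorph_sum sigma) gradient_sum big1 // => l _.
rewrite (rmorphM sigma) gradientM !sev hb scale0r addr0.
by rewrite mevalB mevalXU mevalC subrr scale0r.
Qed.

Section Tangent.
Variable u : 'rV[k]_N.
Hypotheses (u0 : u != 0) (uM : u *m M0 = 0).

Lemma maximal_minor_point s : (maximal_minor d Y s).@[A0] = 0.
Proof.
rewrite /maximal_minor -det_map_mx map_mxsub map_V.
apply/eqP; apply: contraT; rewrite -unitfE -unitmxE => unitM.
case/eqP: u0; rewrite -[u](mulmxK unitM).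
suff -> : u *m colsub s M0 = colsub s (u *m M0).
  by rewrite uM (_ : colsub s 0 = 0) ?mul0mx //; apply/matrixP => a b; rewrite !mxE.
by rewrite mxsub_mul; congr (_ *m _); apply/matrixP => a b; rewrite !mxE.
Qed.

Definition gradients : 'M[k]_(n, n * r) := \matrix_i gradient A0 (local_equation u i).

(** Cramer's rule in row a, where u_a is nonzero: u_a times the minor is the
combination of the local equations of its columns with the cofactors of that
row. The local equations vanish at p, so only their differentials contribute,
and the cofactors at p form a vector of ker M0 because the minor vanishes. *)
Lemma gradient_maximal_minor s :
  (gradient A0 (maximal_minor d Y s) <= kermx (M0)^T *m gradients)%MS.
Proof.
case/rV0Pn: (u0) => a ua; rewrite -(eqmx_scale _ ua).
set Ms := colsub s V.
pose w t := (cofactor Ms a t).@[A0].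
have minorE : (u 0 a)%:MP * \det Ms = \sum_t local_equation u (s t) * cofactor Ms a t.
  transitivity (\sum_b (u 0 b)%:MP * (Ms *m \adj Ms) b a).
    rewrite mul_mx_adj (bigD1 a) //= mxE eqxx mulr1n big1 ?addr0 // => b ne.
    by rewrite mxE (negPf ne) mulr0n mulr0.
  under eq_bigr do rewrite mxE mulr_sumr.
  rewrite exchange_big; apply: eq_bigr => t _ /=.
  by rewrite mulr_suml; apply: eq_bigr => b _; rewrite !mxE mulrA.
have locA i : (local_equation u i).@[A0] = 0.
  by rewrite meval_local_equation uM mxE.
have -> : u 0 a *: gradient A0 (maximal_minor d Y s) =
    (\sum_t w t *: delta_mx 0 (s t)) *m gradients.
  transitivity (gradient A0 ((u 0 a)%:MP * \det Ms)).
    by rewrite gradientM gradientC scaler0 add0r mevalC.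
  rewrite minorE gradient_sum mulmx_suml; apply: eq_bigr => t _.
  by rewrite gradientM locA scale0r addr0 -scalemxAl -rowE rowK.
apply: submxMr; apply/sub_kermxP; rewrite mulmx_suml.
apply/rowP => b; rewrite summxE mxE.
transitivity (((colsub s M0) *m \adj (colsub s M0)) b a); last first.
  rewrite mul_mx_adj mxE; have := maximal_minor_point s.
  by rewrite /maximal_minor -det_map_mx map_mxsub map_V => ->; rewrite mul0rn.
rewrite mxE; apply: eq_bigr => t _.
rewrite -scalemxAl -rowE !mxE mulrC; congr (_ * _).
by rewrite /w -cofactor_map_mx map_mxsub map_V.
Qed.

End Tangent.

End Chart.

(** The column t of cofactors supplies the coefficients of a form. By Laplace
expansion its value at the i-th universal point is the maximal minor with column
t replaced by column i, so it vanishes on X; and the form is nonzero modulo any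
prime contained in the ideal of p, since one cofactor is nonzero at p. *)
Lemma X_chain_bound (k : fieldType) (r d n : nat) (j : 'I_n -> 'I_r.+2)
    (p : 'M[k]_(n, r.+2)) (e : nat) (s : 'I_('C(r.+1 + d, d)) -> 'I_n)
    (a t : 'I_('C(r.+1 + d, d))) :
  cofactor (colsub s (veronese_mx d (normalized j p))) a t != 0 ->
  loc_prime_chain (X_equation d j) (point_ideal (configuration_coord j p)) e ->
  (e <= ('C(r.+1 + d, d)).-1 + n * r)%N.
Proof.
move=> cof0 [P [prP IP Pm chP]].
set V := veronese_mx d (chart_configuration k j).
have [B [pi [domB kerP]]] := prime_quotient (prP ord0).
pose Q (i : nat) : {pred {mpoly k[n * r.+1]}} := P (inord i).
have Q0 : Q 0%N = P ord0 by congr P; apply: val_inj; rewrite /= inordK.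
pose u a := pi (cofactor (colsub s V) a t).
pose y (i : 'I_n) (l : 'I_r.+1) := pi 'X_(mxvec_index i l).
pose m (i : 'I_n) (a : 'I_('C(r.+1 + d, d))) (l : 'I_r.+1) := mon a (lift (j i) l).
have rel i : \sum_a u a * monom (y i) (m i a) = 0.
  pose s' t' := if t' == t then i else s t'.
  have : pi (maximal_minor d (chart_configuration k j) s') = 0.
    by apply/eqP; rewrite -kerP; apply: IP; exists s'.
  rewrite /maximal_minor (expand_det_col _ t) (rmorph_sum pi) => E.
  rewrite -[RHS]E.
  apply: eq_bigr => b _; rewrite [RHS](rmorphM pi) [RHS]mulrC.
  have -> : cofactor (colsub s' V) b t = cofactor (colsub s V) b t.
    rewrite /cofactor; congr (_ * \det _); apply/matrixP => b1 b2.
    by rewrite 3!mxE [RHS]mxE [RHS]mxE [RHS]mxE /s' eq_sym (negPf (neq_lift _ _)).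
  have -> : colsub s' V b t = V b i by rewrite mxE /s' eqxx.
  rewrite veronese_chart (rmorph_prod pi); congr (_ * _).
  by apply: eq_bigr => l _; rewrite (rmorphXn pi).
have unz : exists a, u a != 0.
  exists a; rewrite /u -kerP; apply: contra cof0 => cofP.
  have mono : {subset P ord0 <= P ord_max}.
    case: (posnP e) => [e0|e0]; last by case: (chP ord0 ord_max e0).
    by have -> : ord_max = ord0 :> 'I_e.+1 by apply: val_inj.
  have := Pm _ (mono _ cofP); rewrite mem_point_ideal.
  by rewrite -cofactor_map_mx map_mxsub map_V.
have md i b l : (m i b l <= d)%N by exact: mon_le.
have minj i b b' : m i b =1 m i b' -> b = b'.
  move=> E; apply: mon_inj; apply/mnmP => c.
  have El l : mon b (lift (j i) l) = mon b' (lift (j i) l) := E l.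
  have [l ->|->] := unliftP (j i) c; first exact: El.
  have := mdeg_mon b; rewrite -[in RHS](mdeg_mon b') !mdegE !(bigD1_ord (j i)) //=.
  by rewrite (eq_bigr _ (fun l _ => El l)) => /addIn.
pose iota : {rmorphism k -> B} := pi \o @mpolyC (n * r.+1) k.
apply: (@chain_bound k (n * r.+1) e _ (incidence_const ('C(r.+1 + d, d)).-1 r d n) Q B pi) => //.
- by move=> i _; exact: prP.
- by move=> i ie; apply: chP; rewrite !inordK // ltnW.
- by move=> x; rewrite Q0 kerP.
move=> S.
have [J [b [c [c0 cardJ span]]]] :=
  incidence_growth_pred iota S domB rel md minj unz.
exists J, b, c; split => // mm mS.
pose beta (i : 'I_n) (l : 'I_r.+1) := mm (mxvec_index i l).
have XE : pi 'X_[mm] = \prod_i monom (y i) (beta i).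
  rewrite mpolyXE_id (rmorph_prod pi) (reindex _ (curry_mxvec_bij _ _)) /=.
  rewrite [RHS]pair_bigA; apply: eq_bigr => -[i l] _ /=.
  by rewrite (rmorphXn pi).
have [|lam E] := span beta.
  move=> i; apply: leq_trans mS.
  have -> : mdeg mm = (\sum_i \sum_l beta i l)%N.
    rewrite mdegE pair_bigA (reindex _ (curry_mxvec_bij _ _)) /=.
    by apply: eq_bigr => -[i' l].
  by rewrite (bigD1 i) //= leq_addr.
by exists lam; rewrite XE E.
Qed.

Theorem corollary4p9 (k : fieldType) (r d n : nat)
    (hr : (2 <= r)%N) (hd : (2 <= d)%N) (hn : ('C(r + d, d) <= n)%N)
    (p : 'M[k]_(n, r.+1)) (F : {mpoly k[r.+1]}) :
  configuration p ->
  in_X d p ->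
  unique_hypersurface d p F ->
  has_secant_line d.+2 p (fun i => hypersurface_singular F (row i p)) ->
  X_singular d p.
Proof.
case: r hr hn p F => [//|r] hr hn p F _ inX [Fhom F0 pF uniqF].
move=> [L [J [_ cardJ singJ JL]]]; split=> // -[j [pj [e [[chain _] gen]]]].
set N := 'C(r.+1 + d, d) in hn *.
pose p' := normalized j p; pose M0 := veronese_mx d p'.
pose u : 'rV[k]_N := \row_a F@_(mon a).
have uE : form u = F by rewrite -homog_form.
have p'E i : (fun c => p' i c) =1 (fun c => (p i (j i))^-1 * p i c).
  by move=> c; rewrite /p' normalizedE.
have on_p' (G : {mpoly k[r.+2]}) i : G \is d.-homog ->
    (G.@[fun c => p' i c] == 0) = (G.@[(row i p) 0] == 0).
  move=> hG; rewrite (meval_eq _ (p'E i)) (meval_homogZ _ _ hG) mulf_eq0.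
  rewrite expf_eq0 invr_eq0 (negPf (pj i)) andbF /=; congr (_ == _).
  by apply: meval_eq => c; rewrite mxE.
have u0 : u != 0.
  apply: contraNneq F0 => u0; rewrite -uE u0 /form big1 // => a _.
  by rewrite mxE scale0r.
have uM : u *m M0 = 0.
  apply/rowP => i; rewrite form_veronese uE mxE; apply/eqP.
  by rewrite on_p' //; apply/eqP; exact: pF.
have uniq v : v *m M0 = 0 -> exists c, v = c *: u.
  move=> vM; have [v0|v0] := eqVneq (form v) 0.
    exists 0; rewrite scale0r; apply/rowP => a.
    by rewrite -mcoeff_form v0 mcoeff0 mxE.
  have [i|c E] := uniqF _ (form_homog v) v0.
    by apply/eqP; rewrite -on_p' ?form_homog // -form_veronese vM mxE.
  by exists c; apply/rowP => a; rewrite -mcoeff_form E mcoeffZ !mxE.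
have [s [a [t cof0]]] := corank1_cofactor u0 uM uniq hn.
have le_e := X_chain_bound cof0 chain.
pose K := kermx M0^T; pose Phi := gradients j p u.
have rankK : \rank K = (n - N.-1)%N.
  by rewrite mxrank_ker mxrank_tr -(corank1_rank u0 uM uniq).
have le_emb : (n * r.+1 <= e + \rank (K *m Phi))%N.
  apply: (embedding_dim _ gen) => g [s' ->]; split.
    exact: maximal_minor_point uM _.
  exact: gradient_maximal_minor.
have p'L i : i \in J -> (row i p' <= L)%MS.
  move=> /JL; apply: submx_trans.
  have -> : row i p' = (p i (j i))^-1 *: row i p.
    by apply/rowP => c; rewrite mxE [RHS]mxE [row i p 0 c]mxE -p'E.
  exact: scalemx_sub.
have [v v0 [vM vJ]] := secant_relation cardJ p'L.
have vPhi : v *m Phi = 0.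
  rewrite mulmx_sum_row big1 // => i _; rewrite rowK.
  have [iJ|iJ] := boolP (i \in J); last by rewrite vJ // scale0r.
  have [Fi nreg] := singJ _ iJ.
  suff -> : gradient (configuration_coord j p) (local_equation j u i) = 0 by rewrite scaler0.
  have f0 : (dehomogenize (j i) (form u)).@[chart_coord (j i) (row i p)] = 0.
    rewrite uE; have /eqP : F.@[fun c => p' i c] == 0 by rewrite on_p' //; apply/eqP.
    rewrite /dehomogenize comp_mpoly_meval => E; rewrite -[RHS]E; apply: meval_eq => c.
    rewrite tnth_mktuple /p' normalized_chart !mxE.
    by case: unliftP => [l _|_]; rewrite ?meval1 ?mevalXU.
  apply: local_equation_gradient0 => //; apply/eqP; apply: contraT => grad0.
  case: nreg; exists (j i); split; first by rewrite mxE.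
  by rewrite -uE; exact: smooth_regular.
have : (0 < \rank (K :&: kermx Phi)%MS)%N.
  apply: leq_trans (mxrankS (_ : (v <= _)%MS)); first by rewrite rank_rV v0.
  by rewrite sub_capmx; apply/andP; split; exact/sub_kermxP.
have := mxrank_mul_ker K Phi; rewrite rankK.
have N0 : (0 < N)%N by rewrite bin_gt0 leq_addl.
(* With R = r.+1: n R <= (N - 1) + n (R - 1) + (n - N) = n R - 1. *)
move: le_e le_emb hn (mulnS n r); rewrite -/N; lia.
Qed.
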